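(* Let $\alpha\in\mathbb{Q}\cap(0,1/2)$ with $\alpha\neq1/3$. A number $\mathfrak{z}\in\mathbb{C}$ with positive imaginary part is the first shape parameter of an element of $\mathcal{H}(M_\alpha)$ if and only if $$\mathfrak{z}\in\mathcal{H}(M_\alpha^\circ)\qquad\text{and}\qquad\mathcal{Q}(\alpha)_{\mathfrak z}=0,$$ where $\mathcal{Q}(\alpha)_{\mathfrak z}$ is the value of the polynomial $\mathcal{Q}(\alpha)$ at $x=\mathfrak{z}$, and $\mathfrak{z}\in\mathcal{H}(M_\alpha^\circ)$ means that $\mathfrak{z}$ is the first shape parameter of an element of $\mathcal{H}(M_\alpha^\circ)$.
   Context: Farey notation. $\mathbb{Q}_0=\mathbb{Q}\cap[0,1]$, $\widehat{\mathbb{Q}}_0=\mathbb{Q}_0\cup\{\infty\}$; fractions are in lowest terms with positive denominator, $0=0/1$, $1=1/1$, $\infty=1/0$. A pair $\{p/q,r/s\}\subset\widehat{\mathbb{Q}}_0$ is a Farey pair if $ps-rq=\pm1$; $p/q\oplus r/s=(p+r)/(q+s)$; $\gamma\oplus^0\beta=\gamma$ and $\gamma\oplus^j\beta=(\gamma\oplus^{j-1}\beta)\oplus\beta$. For a Farey pair $e\subset\mathbb{Q}_0$ (an edge) write $e^L<e^R$ for its endpoints. If $e\ne\{0,1\}$, $e^-$ and $e^+$ are the endpoints with smaller and larger denominator, and $\hat e\in\mathbb{Q}_0$ is determined by $\hat e\oplus e^-=e^+$. Polynomials. $d_{\mathcal Q}(p/q)=(-1)^px^q$. $\mathcal{Q}:\widehat{\mathbb{Q}}_0\to\mathbb{Z}[x]$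 is the unique function with $\mathcal{Q}(0)=1$, $\mathcal{Q}(\infty)=0$, $\mathcal{Q}(1)=1$ and $\mathcal{Q}(\gamma\oplus^2\beta)=-d_{\mathcal Q}(\beta)\mathcal{Q}(\gamma)+\mathcal{Q}(\beta)\mathcal{Q}(\gamma\oplus\beta)$ for every Farey pair $\{\beta,\gamma\}$ with $\gamma\oplus^2\beta\in\mathbb{Q}_0$. Funnel. For $\alpha\in\mathbb{Q}\cap(0,1/2)$, $\alpha\ne1/3$, the funnel $F_\alpha$ has edges $e_0,\dots,e_{n+1}$: $e_0=\{0,1\}$; given $e_j$, let $c=e_j^L\oplus e_j^R$; if $c=\alpha$ stop and set $j=n+1$; if $\alpha<c$ then $e_{j+1}=\{e_j^L,c\}$; if $\alpha>c$ then $e_{j+1}=\{c,e_j^R\}$. The interior edges are $e_1,\dots,e_n$ ($n\ge1$). The vertices of $F_\alpha$ are the endpoints of the $e_j$; those of the form $e_j^L$ are on the left side, those of the form $e_j^R$ on the right side. Hyperbolic structures. $M_\alpha$ is the complement in $S^3$ of the 2-bridge link with parameter $\alpha$; its Sakuma--Weeks ideal triangulation has $n$ pairs of tetrahedra $\Delta_1,\dots,\Delta_n$ (one for each interior edge). $M_\alpha^\circ$ is the tangle complement made of the same tetrahedra with the bottom faces left unglued. $\mathcal{H}(M_\alpha)$ and $\mathcal{H}(M^\circ_\alpha)$ are the sets of hyperbolic structures carried by these triangulations which are invariant under the Klein 4-group of simplicial involutions. Concretely, they are the sets of $(z_1,\dots,z_n)\in\mathbb{C}^n$ with all $\operatorname{Im}z_j>0$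 ($z_j$ the common shape parameter of the tetrahedra of $\Delta_j$; $z_1$ is the first shape parameter) solving the following gluing equations. Put $\zeta(t)=1/(1-t)$, $\zeta^2=\zeta\circ\zeta$, $z_0=z_{n+1}=1$. (i) Equation for a vertex $\beta$ of $F_\alpha$ which is not an endpoint of $e_0$ or $e_{n+1}$: with $k,\ell$ the smallest and largest indices of interior edges having $\beta$ as an endpoint, $1=z_{k-1}z_{\ell+1}\big(\prod_{j=k}^{\ell}\zeta(z_j)\big)^2$ if $\beta$ is on the left side, $1=z_{k-1}z_{\ell+1}\big(\prod_{j=k}^{\ell}\zeta^2(z_j)\big)^2$ if $\beta$ is on the right side. (ii) Upper tunnel equation: $-1=z_1z_{\ell+1}\big(\prod_{j=1}^{\ell}\zeta(z_j)\big)^2$, where $\ell$ is the largest index with $e_\ell^-=0$. (iii) Lower tunnel equation: with $\beta=e_{n+1}^-$ and $k$ the smallest index such that $\beta$ is an endpoint of $e_k$: $-1=z_{k-1}z_n\big(\prod_{j=k}^{n}\zeta(z_j)\big)^2$ if $\beta$ is on the left side, $-1=z_{k-1}z_n\big(\prod_{j=k}^{n}\zeta^2(z_j)\big)^2$ otherwise. For $\mathcal{H}(M_\alpha^\circ)$ one imposes (i) for $\beta\ne\hat e_{n+1}$, and (ii) provided $0$ is not an endpoint of $e_{n+1}$ and $0\neq\hat e_{n+1}$. For $\mathcal{H}(M_\alpha)$ one imposes (i) for all $\beta$, (ii) and (iii); if $1/\alpha\in\mathbb{Z}$ the upper and lower tunnels are one and the same edge, and (ii), (iii) are replaced by the single equation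 $-1=z_1z_n\big(\prod_{j=1}^n\zeta(z_j)\big)^2$ for this edge. *)

(* Defs.v *)
From mathcomp Require Import all_boot all_order all_algebra.
From mathcomp Require Import classical_sets reals complex.
From mathcomp Require Import ring lra zify.

Set Implicit Arguments.
Unset Strict Implicit.
Unset Printing Implicit Defensive.

Import Order.TTheory GRing.Theory Num.Theory.
Local Open Scope ring_scope.

(* Extended rationals: [None] is the point at infinity 1/0. *)
Definition xnum (x : option rat) : int := if x is Some r then numq r else 1.
Definition xden (x : option rat) : int := if x is Some r then denq r else 0.

Definition in_Q0 (x : option rat) : bool :=
  if x is Some r then 0 <= r <= 1 else false.
Definition in_hatQ0 (x : option rat) : bool := (x == None) || in_Q0 x.

Definition farey_pair (x y : option rat) : bool :=
  `|xnum x * xden y - xnum y * xden x| == 1.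

(* The fraction n/d, where d = 0 gives the point at infinity. *)
Definition xfrac (n d : int) : option rat :=
  if d == 0 then None else Some (n%:Q / d%:Q).

Definition xmediant (x y : option rat) : option rat :=
  xfrac (xnum x + xnum y) (xden x + xden y).

(* xmediantn j g b is g (+)^j b. *)
Definition xmediantn (j : nat) (g b : option rat) : option rat :=
  iter j (fun x => xmediant x b) g.

Definition dQ (x : option rat) : {poly int} :=
  (-1) ^+ `|xnum x|%N * 'X^`|xden x|%N.

(* The defining properties of the function calligraphic Q.  They determine its
   values on the extended rationals of [0, 1] (see [is_calQ_exists] and
   [is_calQ_unique]); the values elsewhere are irrelevant. *)
Definition is_calQ (Q : option rat -> {poly int}) : Prop :=
  [/\ Q (Some 0) = 1, Q None = 0, Q (Some 1) = 1 &
      forall b g : option rat,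
        in_hatQ0 b -> in_hatQ0 g -> farey_pair b g ->
        in_Q0 (xmediantn 2 g b) ->
        Q (xmediantn 2 g b) = - dQ b * Q g + Q b * Q (xmediant g b)].

Definition mediant (r s : rat) : rat :=
  (numq r + numq s)%:Q / (denq r + denq s)%:Q.

(* An edge is stored as the pair (e^L, e^R). *)
Definition edge : Type := (rat * rat)%type.

Definition incident (b : rat) (e : edge) : bool := (b == e.1) || (b == e.2).

Definition edge_minus (e : edge) : rat :=
  if denq e.1 <= denq e.2 then e.1 else e.2.
Definition edge_plus (e : edge) : rat :=
  if denq e.1 <= denq e.2 then e.2 else e.1.

(* Solution of [mediant g (edge_minus e) = edge_plus e] among the Farey
   neighbours g of [edge_minus e]; see [edge_hatP]. *)
Definition edge_hat (e : edge) : rat :=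
  (numq (edge_plus e) - numq (edge_minus e))%:Q /
  (denq (edge_plus e) - denq (edge_minus e))%:Q.

Definition funnel_next (a : rat) (e : edge) : edge :=
  let c := mediant e.1 e.2 in if a < c then (e.1, c) else (c, e.2).

(* e_j for j <= n+1; the values for larger j are meaningless. *)
Definition funnel_edge (a : rat) (j : nat) : edge :=
  iter j (funnel_next a) (0, 1).

(* The number n of interior edges: n+1 is the first index j at which the mediant
   of the endpoints of e_j is a.  It is smaller than the denominator of a;
   see [funnel_sizeP]. *)
Definition funnel_size (a : rat) : nat :=
  (find (fun j => mediant (funnel_edge a j).1 (funnel_edge a j).2 == a)
        (iota 0 `|denq a|)).-1.

Definition funnel_last (a : rat) : edge := funnel_edge a (funnel_size a).+1.

Definition left_side (a : rat) : seq rat :=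
  [seq (funnel_edge a j).1 | j <- iota 0 (funnel_size a).+2].
Definition right_side (a : rat) : seq rat :=
  [seq (funnel_edge a j).2 | j <- iota 0 (funnel_size a).+2].
Definition funnel_vertices (a : rat) : seq rat := left_side a ++ right_side a.

(* The vertices which are not endpoints of e_0 or e_{n+1}. *)
Definition inner_vertex (a b : rat) : bool :=
  [&& b \in funnel_vertices a, ~~ incident b (funnel_edge a 0)
    & ~~ incident b (funnel_last a)].

(* The lists below are increasing, so that their first and last elements are
   the smallest and the largest indices. *)
Definition interior_indices (a b : rat) : seq nat :=
  [seq j <- iota 1 (funnel_size a) | incident b (funnel_edge a j)].
Definition first_interior (a b : rat) : nat := head 0%N (interior_indices a b).
Definition last_interior (a b : rat) : nat := last 0%N (interior_indices a b).

(* e_0^- is undefined, so that the indices start at 1. *)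
Definition upper_index (a : rat) : nat :=
  last 0%N [seq j <- iota 1 (funnel_size a).+1
           | edge_minus (funnel_edge a j) == 0].
Definition lower_index (a : rat) : nat :=
  head 0%N [seq j <- iota 0 (funnel_size a).+2
           | incident (edge_minus (funnel_last a)) (funnel_edge a j)].

Definition zeta (F : fieldType) (t : F) : F := (1 - t)^-1.

(* A point of C^n is a tuple (z_1, ..., z_n); z_0 = 1 is put in front, and
   z_{n+1} = 1 is the default value of [nth]. *)
Definition shape (F : fieldType) (n : nat) (z : n.-tuple F) (j : nat) : F :=
  nth 1 (1 :: val z) j.

Definition corner (F : fieldType) (a b : rat) (t : F) : F :=
  if b \in left_side a then zeta t else zeta (zeta t).

Definition vertex_eq (F : fieldType) (a b : rat)
    (z : (funnel_size a).-tuple F) : Prop :=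
  let k := first_interior a b in
  let l := last_interior a b in
  1 = shape z k.-1 * shape z l.+1 *
      (\prod_(k <= j < l.+1) corner a b (shape z j)) ^+ 2.

Definition upper_tunnel_eq (F : fieldType) (a : rat)
    (z : (funnel_size a).-tuple F) : Prop :=
  let l := upper_index a in
  -1 = shape z 1 * shape z l.+1 *
       (\prod_(1 <= j < l.+1) zeta (shape z j)) ^+ 2.

Definition lower_tunnel_eq (F : fieldType) (a : rat)
    (z : (funnel_size a).-tuple F) : Prop :=
  let k := lower_index a in
  let n := funnel_size a in
  -1 = shape z k.-1 * shape z n *
       (\prod_(k <= j < n.+1)
           corner a (edge_minus (funnel_last a)) (shape z j)) ^+ 2.

Definition common_tunnel_eq (F : fieldType) (a : rat)
    (z : (funnel_size a).-tuple F) : Prop :=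
  let n := funnel_size a in
  -1 = shape z 1 * shape z n *
       (\prod_(1 <= j < n.+1) zeta (shape z j)) ^+ 2.

Definition positive_shapes (R : realType) (n : nat) (z : n.-tuple R[i]) : Prop :=
  forall t : R[i], t \in z -> 0 < complex.Im t.

Definition hyp_link (R : realType) (a : rat) :
    set ((funnel_size a).-tuple R[i]) :=
  fun z =>
  [/\ positive_shapes z,
      forall b : rat, inner_vertex a b -> vertex_eq b z &
      if a^-1 \is a Num.int then common_tunnel_eq z
      else upper_tunnel_eq z /\ lower_tunnel_eq z].

Definition hyp_tangle (R : realType) (a : rat) :
    set ((funnel_size a).-tuple R[i]) :=
  fun z =>
  [/\ positive_shapes z,
      forall b : rat, inner_vertex a b -> b != edge_hat (funnel_last a) ->
        vertex_eq b z &
      ~~ incident 0 (funnel_last a) -> 0 != edge_hat (funnel_last a) ->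
        upper_tunnel_eq z].

Arguments hyp_link : clear implicits.
Arguments hyp_tangle : clear implicits.

Definition first_shape_of (R : realType) (n : nat) (H : set (n.-tuple R[i]))
    (z : R[i]) : Prop :=
  exists2 t, H t & shape t 1 = z.

Definition evalC (R : realType) (p : {poly int}) (z : R[i]) : R[i] :=
  (map_poly intr p).[z].

Lemma coprimez_det (p q u v : int) : `|p * u - q * v| = 1 -> coprime `|p| `|q|.
Proof.
move=> h; have : (gcdz p q %| p * u - q * v)%Z.
  by rewrite rpredB // dvdz_mulr ?dvdz_gcdl ?dvdz_gcdr.
have [->|->] : p * u - q * v = 1 \/ p * u - q * v = -1 by lia.
  by rewrite dvdz1.
by rewrite dvdzE dvdn1.
Qed.

Lemma frac_num (p q u v : int) : 0 < q -> `|p * u - q * v| = 1 ->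
  numq (p%:Q / q%:Q) = p /\ denq (p%:Q / q%:Q) = q.
Proof.
move=> q0 /coprimez_det h; rewrite coprimeq_num // coprimeq_den //.
by rewrite gtr0_sg // mul1r (gt_eqF q0); split=> //; lia.
Qed.

Lemma xmediant_nd (x y : option rat) : farey_pair x y -> 0 < xden x + xden y ->
  xnum (xmediant x y) = xnum x + xnum y /\ xden (xmediant x y) = xden x + xden y.
Proof.
move=> /eqP h d0; rewrite /xmediant /xfrac (gt_eqF d0) /=.
by apply: (@frac_num _ _ (xden y) (xnum y)) => //; rewrite -h; congr `|_|; ring.
Qed.

Lemma xden_ge0 x : 0 <= xden x.
Proof. by case: x => //= r; apply: ltW; apply: denq_gt0. Qed.

Lemma xnd_inj x y : xnum x = xnum y -> xden x = xden y -> x = y.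
Proof.
case: x y => [r|] [s|] //= h1 h2.
- by congr Some; rewrite -(divq_num_den r) h1 h2 divq_num_den.
- by have := denq_gt0 r; lia.
by have := denq_gt0 s; lia.
Qed.

Lemma in_Q0_nd x : in_Q0 x = [&& 0 < xden x, 0 <= xnum x & xnum x <= xden x].
Proof.
case: x => //= r; rewrite denq_gt0 /= numq_ge0; congr (_ && _).
rewrite -{1}(divq_num_den r) ler_pdivrMr ?ltr0z ?denq_gt0 // mul1r.
by rewrite ler_int.
Qed.

Lemma in_hatQ0_nd x : in_hatQ0 x =
  ((xden x == 0) && (xnum x == 1)) || [&& 0 < xden x, 0 <= xnum x & xnum x <= xden x].
Proof.
rewrite /in_hatQ0 in_Q0_nd; case: x => //= r.
by rewrite denq_eq0.
Qed.

Lemma fareyC x y : farey_pair x y = farey_pair y x.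
Proof. by rewrite /farey_pair distrC. Qed.

(* x = g (+)^2 b, as in the recursion for Q. *)
Definition decomp (x b g : option rat) : Prop :=
  [/\ in_hatQ0 b, in_hatQ0 g, farey_pair b g & x = xmediantn 2 g b].

Lemma decomp_nd x b g : in_Q0 x -> decomp x b g ->
  [/\ xnum (xmediant g b) = xnum g + xnum b, xden (xmediant g b) = xden g + xden b,
      xnum x = xnum g + 2 * xnum b & xden x = xden g + 2 * xden b].
Proof.
move=> hx [hb hg hf ex].
have bg : 0 < xden g + xden b.
  rewrite lt_neqAle addr_ge0 ?xden_ge0 // andbT eq_sym paddr_eq0 ?xden_ge0 //.
  by apply: contraL hf => /andP[/eqP g0 /eqP b0]; rewrite /farey_pair g0 b0 !mulr0.
have hf' : farey_pair g b by rewrite fareyC.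
have [e1 e2] := xmediant_nd hf' bg.
have hf2 : farey_pair (xmediant g b) b.
  rewrite /farey_pair e1 e2; move: hf'; rewrite /farey_pair => /eqP <-.
  by apply/eqP; congr `|_|; ring.
have d2 : 0 < xden (xmediant g b) + xden b by rewrite e2; have := xden_ge0 b; lia.
have [f1 f2] := xmediant_nd hf2 d2.
by rewrite ex /= f1 f2 e1 e2; split=> //; ring.
Qed.

Lemma decomp_b x b g : in_Q0 x -> decomp x b g -> 0 < xden b.
Proof.
move=> hx D; have [_ _ h1 h2] := decomp_nd hx D; case: D => hb hg /eqP hf _.
have := xden_ge0 b; move: hx hb hg; rewrite in_Q0_nd !in_hatQ0_nd h1 h2.
move: hf; move: (xden b) (xden g) (xnum b) (xnum g) => bd gd bn gn.
move=> hf /and3P[x1 x2 x3].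
case/orP=> [/andP[/eqP b0 /eqP b1]|/and3P[//]].
rewrite {}b0 {}b1 in hf x1 x2 x3 *.
by case/orP=> [/andP[/eqP g0 /eqP g1]|/and3P[g0 g1 g2]]; rewrite ?g0 ?g1 in hf x1 x3; lia.
Qed.

Lemma decomp_lt x b g : in_Q0 x -> decomp x b g ->
  [/\ xden b < xden x, xden g < xden x & xden (xmediant g b) < xden x].
Proof.
move=> hx D; have := decomp_b hx D; have [_ -> _ ->] := decomp_nd hx D.
have := xden_ge0 g; split; lia.
Qed.

Lemma small_mul (q k d : int) : d = q * k -> `|d| < q -> d = 0.
Proof.
move=> ->; have [->|k0] := eqVneq k 0; first by rewrite mulr0.
have k1 : 1 <= `|k| by lia.
have [q0|q0] := lerP 0 q; last by have := normr_ge0 (q * k); lia.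
rewrite normrM (ger0_norm q0) => h.
have := ler_wpM2l q0 k1; lia.
Qed.

Lemma decomp_uniq x b g b' g' : in_Q0 x -> decomp x b g -> decomp x b' g' ->
  b = b' /\ g = g'.
Proof.
move=> hx D D'; have B := decomp_b hx D; have B' := decomp_b hx D'.
have [_ _ h1 h2] := decomp_nd hx D; have [_ _ h1' h2'] := decomp_nd hx D'.
case: D => hb hg /eqP hf _; case: D' => hb' hg' /eqP hf' _.
have gd := xden_ge0 g; have gd' := xden_ge0 g'.
have g0 : xden g = 0 -> xnum g = 1.
  by move: hg; rewrite in_hatQ0_nd; lia.
have g0' : xden g' = 0 -> xnum g' = 1.
  by move: hg'; rewrite in_hatQ0_nd; lia.
suff [e1 e2] : xnum b = xnum b' /\ xden b = xden b'.
  by split; apply: xnd_inj => //; lia.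
clear hb hg hb' hg' hx.
move: (xden b) (xden g) (xnum b) (xnum g) (xden b') (xden g') (xnum b') (xnum g')
  h1 h2 h1' h2' hf hf' B B' gd gd' g0 g0'.
move: (xden x) (xnum x) => q p bd gd bn gn bd' gd' bn' gn'.
move=> h1 h2 h1' h2' hf hf' B B' gd_0 gd_0' g0 g0'.
have s : `|p * bd - q * bn| = 1.
  by rewrite -hf -normrN; congr `|_|; rewrite h1 h2; ring.
have s' : `|p * bd' - q * bn'| = 1.
  by rewrite -hf' -normrN; congr `|_|; rewrite h1' h2'; ring.
have [E|E] : p * (bd - bd') = q * (bn - bn') \/ p * (bd + bd') = q * (bn + bn').
  by clear -s s'; lia.
- have G : exists k, bd - bd' = q * k.
    have C : coprimez q p.
      apply: (@coprimez_det q p (- bn) (- bd)); rewrite -s; congr `|_|; ring.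
    have /dvdzP[k ->] : (q %| bd - bd')%Z.
      by rewrite -(Gauss_dvdzr _ C) E dvdz_mulr.
    by exists k; rewrite mulrC.
  case: G => k /small_mul hk; have : bd = bd' by lia.
  move=> h; split=> //; have : q * (bn - bn') = 0 by rewrite -E h; ring.
  by move=> /eqP; rewrite mulf_eq0; lia.
have G : exists k, bd + bd' = q * k.
  have C : coprimez q p.
    apply: (@coprimez_det q p (- bn) (- bd)); rewrite -s; congr `|_|; ring.
  have /dvdzP[k ->] : (q %| bd + bd')%Z.
    by rewrite -(Gauss_dvdzr _ C) E dvdz_mulr.
  by exists k; rewrite mulrC.
case: G => k hk.
have {}hk : bd + bd' - q = q * (k - 1) by rewrite hk; ring.
have k1 := small_mul hk.
have gz : gd = 0 by lia.
have gz' : gd' = 0 by lia.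
have bE : q = 2 * bd by lia.
have bE' : bd' = bd by lia.
move: (g0 gz) (g0' gz') => e1 e2; rewrite {}gz e1 in hf.
have b1 : bd = 1 by lia.
move: E; rewrite bE bE' b1; lia.
Qed.

(* Q computed with recursion depth at most m. *)
Fixpoint calQ_rec (m : nat) (x : option rat) : {poly int} :=
  if m isn't m'.+1 then 0 else
  if x == None then 0 else if (x == Some 0) || (x == Some 1) then 1 else
  let bg := xget (None, None) [set bg | decomp x bg.1 bg.2] in
  - dQ bg.1 * calQ_rec m' bg.2 +
  calQ_rec m' bg.1 * calQ_rec m' (xmediant bg.2 bg.1).

Lemma decomp_neq01 x b g : in_Q0 x -> decomp x b g ->
  (x == None) || (x == Some 0) || (x == Some 1) = false.
Proof.
move=> hx D; have B := decomp_b hx D; have [_ _ e1 e2] := decomp_nd hx D.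
have [hb hg hf _] := D; move: (xden_ge0 g) => gd.
case: x hx D e1 e2 => //= r _ _ e1 e2.
apply/negbTE/norP; split; apply/eqP => -[rE]; move: e1 e2 hb hg hf; rewrite rE /=.
  have -> : numq 0 = 0 by []. have -> : denq 0 = 1 by [].
  rewrite !in_hatQ0_nd /farey_pair; move: (xden b) (xnum b) (xden g) (xnum g) B gd.
  move=> bd bn gd gn B g0 e1 e2 hb hg; have -> : bn = 0 by lia.
  have -> : gn = 0 by lia.
  by rewrite !mul0r subrr normr0.
have -> : numq 1 = 1 by []. have -> : denq 1 = 1 by []. lia.
Qed.

Lemma xget_decomp x b g : in_Q0 x -> decomp x b g ->
  xget (None, None) [set bg | decomp x bg.1 bg.2] = (b, g).
Proof.
move=> hx D; case: xgetP => [[b' g'] _ /= D'|/(_ (b, g))]; last by case.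
by have [-> ->] := decomp_uniq hx D D'.
Qed.

Lemma bezout_pos (p q : int) : 1 < q -> coprimez p q ->
  exists u v, 0 < u < q /\ p * u - q * v = 1.
Proof.
move=> q1 /eqP C; have [u [v E]] := Bezoutz p q; rewrite C in E.
have D := divz_eq u q; have R0 : 0 <= (u %% q)%Z by apply: modz_ge0; lia.
have R1 : (u %% q)%Z < q by apply: ltz_pmod; lia.
move: (u %% q)%Z (u %/ q)%Z D R0 R1 => r k D R0 R1.
have E' : p * r - q * (- v - p * k) = 1 by rewrite -E D; ring.
exists r, (- v - p * k); split => //; apply/andP; split=> //.
rewrite lt_neqAle R0 andbT; apply/eqP => r0.
move: E'; rewrite -r0; move: (- v - p * k) => w; rewrite mulr0 sub0r -mulrN.
move: (- w) => w' h; have : w' = 1 \/ w' <= 0 \/ 2 <= w' by lia.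
nia.
Qed.

Lemma has_decomp_nd (x : option rat) (bn bd gn gd : int) :
  in_Q0 x -> 0 < bd -> 0 <= gd -> `|bn * gd - gn * bd| = 1 ->
  0 <= bn <= bd -> (gd == 0) && (gn == 1) || [&& 0 < gd, 0 <= gn & gn <= gd] ->
  xnum x = gn + 2 * bn -> xden x = gd + 2 * bd ->
  exists b g, decomp x b g.
Proof.
move=> hx b0 g0 d hb hg e1 e2.
have [bE1 bE2] : xnum (xfrac bn bd) = bn /\ xden (xfrac bn bd) = bd.
  by rewrite /xfrac (gt_eqF b0); apply: (@frac_num _ _ gd gn) => //; rewrite [bd * _]mulrC.
have [gE1 gE2] : xnum (xfrac gn gd) = gn /\ xden (xfrac gn gd) = gd.
  rewrite /xfrac; have [gd0|gd0] := eqVneq gd 0; first by rewrite /=; lia.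
  by apply: (@frac_num _ _ bd bn); [lia|rewrite distrC [gd * _]mulrC].
move: (xfrac bn bd) (xfrac gn gd) bE1 bE2 gE1 gE2 => b g bE1 bE2 gE1 gE2.
exists b, g; have hf : farey_pair b g by rewrite /farey_pair bE1 bE2 gE1 gE2 d.
split => //; rewrite ?in_hatQ0_nd ?bE1 ?bE2 ?gE1 ?gE2 //.
  by apply/orP; right; rewrite b0.
have hf' : farey_pair g b by rewrite fareyC.
have [f1 f2] : xnum (xmediant g b) = gn + bn /\ xden (xmediant g b) = gd + bd.
  by rewrite -bE1 -bE2 -gE1 -gE2; apply: xmediant_nd => //; lia.
have hf2 : farey_pair (xmediant g b) b.
  by rewrite /farey_pair f1 f2 bE1 bE2 -d distrC; apply/eqP; congr `|_|; ring.
have [|h1 h2] := xmediant_nd hf2; first by lia.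
by apply: xnd_inj; rewrite /= ?h1 ?h2 ?f1 ?f2; lia.
Qed.

Lemma det_bound (p q u v s : int) : 0 <= p <= q -> 0 <= u ->
  p * u - q * v = s -> `|s| < q -> 0 <= v <= u.
Proof.
move=> hp hu E hs; apply/andP; split.
  rewrite leNgt; apply/negP => v0.
  have h1 : 0 <= p * u by apply: mulr_ge0; lia.
  have h2 : q * v <= q * -1 by apply: ler_wpM2l; lia.
  lia.
rewrite leNgt; apply/negP => v0.
have h1 : p * u <= q * u by apply: ler_wpM2r; lia.
have h2 : q * (u + 1) <= q * v by apply: ler_wpM2l; lia.
lia.
Qed.

Lemma has_decomp x : in_Q0 x -> x != Some 0 -> x != Some 1 ->
  exists b g, decomp x b g.
Proof.
move=> hx x0 x1; have := hx; rewrite in_Q0_nd => /and3P[d0 n0 nd].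
have C : coprimez (xnum x) (xden x).
  by case: x hx x0 x1 d0 n0 nd => //= r *; apply: coprime_num_den.
have q1 : 1 < xden x.
  rewrite ltNge; apply/negP => d1'; have d1 : xden x = 1 by lia.
  have [p0|p1] : xnum x = 0 \/ xnum x = 1 by lia.
    by move/eqP: x0; apply; apply: xnd_inj.
  by move/eqP: x1; apply; apply: xnd_inj.
have [u [v [hu E]]] := bezout_pos q1 C.
have {C E} [u1 [v1 [s [hu1 cmp E hs]]]] : exists u v s, [/\ 0 < u < xden x,
    2 * u <= xden x, xnum x * u - xden x * v = s & `|s| = 1].
  have [cmp|cmp] := lerP (2 * u) (xden x).
    by exists u, v, 1.
  exists (xden x - u), (xnum x - v), (-1); split => //; [lia|lia|].
  by rewrite -E; ring.
have Hp : 0 <= xnum x <= xden x by rewrite n0.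
have Hv : 0 <= v1 <= u1 by apply: det_bound E _ => //; lia.
move: cmp; rewrite le_eqVlt => /orP[/eqP cmp|cmp].
  have Z : u1 * (xnum x - 2 * v1) = s by rewrite -E -cmp; ring.
  have u1E : u1 = 1.
    have /andP[u0 _] := hu1.
    have := hs; rewrite -Z normrM (gtr0_norm u0).
    have := normr_ge0 (xnum x - 2 * v1).
    move: (`|_|) => w w0 h.
    have [w1|w1] : w = 0 \/ 1 <= w by lia.
      by rewrite w1 mulr0 in h.
    by have := ler_wpM2l (ltW u0) w1; lia.
  have pE : xnum x = 1 by lia.
  by apply: (@has_decomp_nd x 0 1 1 0) => //; lia.
have E2 : xnum x * (xden x - 2 * u1) - xden x * (xnum x - 2 * v1) = - 2 * s.
  by rewrite -E; ring.
have Hg : 0 <= xnum x - 2 * v1 <= xden x - 2 * u1.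
  by apply: det_bound E2 _ => //; lia.
apply: (@has_decomp_nd x v1 u1 (xnum x - 2 * v1) (xden x - 2 * u1)) => //; lia.
Qed.

Lemma hatQ0_case x : in_hatQ0 x ->
  [\/ x = None, x = Some 0, x = Some 1 |
     in_Q0 x /\ exists b g, decomp x b g].
Proof.
rewrite /in_hatQ0 => /orP[/eqP|hx]; first by constructor 1.
have [|h0] := eqVneq x (Some 0); first by constructor 2.
have [|h1] := eqVneq x (Some 1); first by constructor 3.
by constructor 4; split => //; apply: has_decomp.
Qed.

Lemma in_hatQ0_med x b g : in_Q0 x -> decomp x b g -> in_hatQ0 (xmediant g b).
Proof.
move=> hx D; have B := decomp_b hx D; have [e1 e2 e3 e4] := decomp_nd hx D.
have [hb hg _ _] := D.
move: hx hb hg; rewrite in_Q0_nd !in_hatQ0_nd e1 e2 e3 e4; lia.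
Qed.

Lemma calQ_recS m x b g : in_Q0 x -> decomp x b g -> calQ_rec m.+1 x =
  - dQ b * calQ_rec m g + calQ_rec m b * calQ_rec m (xmediant g b).
Proof.
move=> hx D /=; have := decomp_neq01 hx D; rewrite (xget_decomp hx D).
by case: eqP => //= _ ->.
Qed.

Lemma calQ_rec_stable m m' x : in_hatQ0 x ->
  xden x < m%:Z -> xden x < m'%:Z -> calQ_rec m x = calQ_rec m' x.
Proof.
elim: m m' x => [|m IH] [|m'] x hx h h'; have := xden_ge0 x; try lia.
move=> _; case: (hatQ0_case hx) => [->|->|->|[{}hx [b [g D]]]] //.
rewrite !(calQ_recS _ hx D); have [l1 l2 l3] := decomp_lt hx D.
have [hb hg _ _] := D; have hm := in_hatQ0_med hx D.
congr (_ * _ + _ * _); apply: IH => //; lia.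
Qed.

Lemma is_calQ_exists : exists Q, is_calQ Q.
Proof.
exists (fun x => calQ_rec (`|xden x|.+1) x); split => // b g hb hg hf hx.
have D : decomp (xmediantn 2 g b) b g by [].
have [l1 l2 l3] := decomp_lt hx D; have hm := in_hatQ0_med hx D.
rewrite (calQ_recS _ hx D); have dx := xden_ge0 (xmediantn 2 g b).
have db := xden_ge0 b; have dg := xden_ge0 g.
have dm := xden_ge0 (xmediant g b).
by congr (_ * _ + _ * _); apply: calQ_rec_stable => //; lia.
Qed.

Lemma is_calQ_unique Q Q' : is_calQ Q -> is_calQ Q' ->
  forall x, in_hatQ0 x -> Q x = Q' x.
Proof.
move=> [Q0 Qi Q1 QE] [Q0' Qi' Q1' QE'] x hx.
have [m] : exists m : nat, xden x < m%:Z.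
  by exists (`|xden x|.+1); have := xden_ge0 x; lia.
elim: m x hx => [|m IH] x hx h; first by have := xden_ge0 x; lia.
case: (hatQ0_case hx) => [->|->|->|[{}hx [b [g D]]]]; rewrite ?Qi ?Q0 ?Q1 //.
have [l1 l2 l3] := decomp_lt hx D; have hm := in_hatQ0_med hx D.
have [hb hg hf ex] := D; rewrite ex in hx l1 l2 l3 h *.
by rewrite QE // QE' // !IH //; lia.
Qed.

(* The funnel terminates, and [edge_hat e] is well defined. *)
Lemma ltq_nd (r s : rat) : (r < s) = (numq r * denq s < numq s * denq r).
Proof.
rewrite -{1}(divq_num_den r) -{1}(divq_num_den s).
rewrite ltr_pdivrMr ?ltr0z ?denq_gt0 // mulrAC ltr_pdivlMr ?ltr0z ?denq_gt0 //.
by rewrite -!intrM ltr_int.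
Qed.

Lemma xmediant_Some r s : xmediant (Some r) (Some s) = Some (mediant r s).
Proof. by rewrite /xmediant /xfrac gt_eqF // addr_gt0 ?denq_gt0. Qed.

Lemma mediant_nd r s : farey_pair (Some r) (Some s) ->
  numq (mediant r s) = numq r + numq s /\ denq (mediant r s) = denq r + denq s.
Proof.
move=> h; have := @xmediant_nd _ _ h; rewrite xmediant_Some /=.
by apply; rewrite addr_gt0 ?denq_gt0.
Qed.

Definition funnel_inv (a : rat) (e : edge) : bool :=
  [&& 0 <= e.1, e.1 < a, a < e.2, e.2 <= 1 & farey_pair (Some e.1) (Some e.2)].

Lemma funnel_inv_den a e : funnel_inv a e -> denq e.1 + denq e.2 <= denq a.
Proof.
case: e => r s /and5P[/= _]; rewrite !ltq_nd /farey_pair /= => h1 h2 _ /eqP hf.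
have := denq_gt0 r; have := denq_gt0 s; have := denq_gt0 a.
move: (denq r) (denq s) (denq a) (numq r) (numq s) (numq a) h1 h2 hf.
move=> rd sd ad rn sn an h1 h2 hf a0 s0 r0.
have D : sn * rd - rn * sd = 1.
  have [//|D] : sn * rd - rn * sd = 1 \/ sn * rd - rn * sd = -1 by lia.
  have h3 : 0 < (an * rd - rn * ad) * sd by rewrite mulr_gt0 // subr_gt0.
  have h4 : 0 < (sn * ad - an * sd) * rd by rewrite mulr_gt0 // subr_gt0.
  have : (an * rd - rn * ad) * sd + (sn * ad - an * sd) * rd = - ad.
    by transitivity ((sn * rd - rn * sd) * ad); [ring|rewrite D mulN1r].
  lia.
have E : ad = (an * rd - rn * ad) * sd + (sn * ad - an * sd) * rd.
  by transitivity ((sn * rd - rn * sd) * ad); [rewrite D mul1r|ring].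
have h3 : 1 * sd <= (an * rd - rn * ad) * sd by apply: ler_wpM2r; lia.
have h4 : 1 * rd <= (sn * ad - an * sd) * rd by apply: ler_wpM2r; lia.
lia.
Qed.

Lemma funnel_next_inv a e : funnel_inv a e -> mediant e.1 e.2 != a ->
  funnel_inv a (funnel_next a e) /\
  denq e.1 + denq e.2 < denq (funnel_next a e).1 + denq (funnel_next a e).2.
Proof.
case: e => r s /and5P[/= r0 ra as_ s1 hf] ca.
have [e1 e2] := mediant_nd hf.
have rs := lt_trans ra as_.
have rm : r < mediant r s.
  by move: rs; rewrite !ltq_nd e1 e2; lia.
have ms : mediant r s < s.
  by move: rs; rewrite !ltq_nd e1 e2; lia.
have dr := denq_gt0 r; have ds := denq_gt0 s.
rewrite /funnel_next /funnel_inv /=; case: ltgtP ca => //= am _; split; try lia.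
  rewrite r0 ra am (le_trans (ltW ms)) //= /farey_pair /= e1 e2.
  by move: hf; rewrite /farey_pair /= => /eqP <-; apply/eqP; congr `|_|; ring.
rewrite as_ am s1 (le_trans r0 (ltW rm)) //= /farey_pair /= e1 e2.
by move: hf; rewrite /farey_pair /= => /eqP <-; apply/eqP; congr `|_|; ring.
Qed.

Definition stops (a : rat) (j : nat) : bool :=
  mediant (funnel_edge a j).1 (funnel_edge a j).2 == a.

Lemma funnel_edge_inv a j : 0 < a < 1 -> (forall i, (i < j)%N -> ~~ stops a i) ->
  funnel_inv a (funnel_edge a j) /\
  j.+2%:Z <= denq (funnel_edge a j).1 + denq (funnel_edge a j).2.
Proof.
move=> ha; elim: j => [|j IH] h.
  by rewrite /funnel_inv /=; case/andP: ha => -> ->.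
have [|I1 I2] := IH; first by move=> i ij; apply: h; lia.
have [J1 J2] := funnel_next_inv I1 (h j (ltnSn j)).
by split; [exact: J1|rewrite /funnel_edge iterS -/(funnel_edge a j); lia].
Qed.

Lemma has_stop a : 0 < a < 1 -> has (stops a) (iota 0 `|denq a|).
Proof.
move=> ha; apply/negPn/negP => /hasPn h.
have [|I1 I2] := @funnel_edge_inv a `|denq a| ha.
  by move=> i ij; apply: h; rewrite mem_iota add0n.
have := funnel_inv_den I1; lia.
Qed.

Lemma mediant01 : mediant 0 1 = 1 / 2. Proof. exact/eqP. Qed.
Lemma mediant02 : mediant 0 (1 / 2) = 1 / 3. Proof. exact/eqP. Qed.

Lemma funnel_sizeP a : 0 < a -> a < 1 / 2 -> a <> 1 / 3 ->
  [/\ (0 < funnel_size a)%N,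
      forall j, (j <= funnel_size a)%N ->
        mediant (funnel_edge a j).1 (funnel_edge a j).2 <> a,
      mediant (funnel_last a).1 (funnel_last a).2 = a
    & forall j, (j <= (funnel_size a).+1)%N ->
        [/\ 0 <= (funnel_edge a j).1, (funnel_edge a j).1 < a,
            a < (funnel_edge a j).2, (funnel_edge a j).2 <= 1
          & farey_pair (Some (funnel_edge a j).1) (Some (funnel_edge a j).2)]].
Proof.
move=> a0 a2 a3; have ha : 0 < a < 1 by rewrite a0 (lt_trans a2).
have hs := has_stop ha; have := nth_find 0%N hs; have := hs; rewrite has_find size_iota.
move=> lt_f; rewrite nth_iota // add0n.
have nb j : (j < find (stops a) (iota 0 `|denq a|))%N -> ~~ stops a j.
  move=> jf; have := before_find 0%N jf.
  by rewrite nth_iota ?(ltn_trans jf) // add0n => ->.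
rewrite /funnel_last /funnel_size -/(stops a).
move: (find _ _) nb => f nb sf.
have s0 : ~~ stops a 0.
  by rewrite /stops /= mediant01; apply/eqP => h; rewrite h ltxx in a2.
have s1 : ~~ stops a 1.
  rewrite /stops /funnel_edge /= /funnel_next /= mediant01 a2 /= mediant02.
  by apply/eqP => h; apply: a3.
case: f nb sf => [|[|n]] nb sf; rewrite ?sf // in s0 s1.
split => //= [j jn|| j jn].
- by apply/eqP; apply: nb.
- exact/eqP.
have [|/and5P[] *] := @funnel_edge_inv a j ha; last by split.
by move=> i ij; apply: nb; lia.
Qed.

Lemma edge_hatP (e : edge) : e.1 < e.2 -> in_Q0 (Some e.1) -> in_Q0 (Some e.2) ->
  farey_pair (Some e.1) (Some e.2) -> e != (0, 1) ->
  forall g : rat,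
    (g = edge_hat e) <->
    [/\ in_Q0 (Some g), farey_pair (Some g) (Some (edge_minus e))
      & mediant g (edge_minus e) = edge_plus e].
Proof.
move=> lt_e h1 h2 hf ne g.
have dn : denq e.1 != denq e.2.
  apply: contra_neq ne => d; case: e lt_e h1 h2 hf d => r s /= lt_e h1 h2 hf d.
  have := denq_gt0 s => s0; move: hf; rewrite /farey_pair /= d -mulrBl normrM.
  rewrite (gtr0_norm s0) => /eqP hs.
  have s1 : denq s = 1.
    have n0 := normr_ge0 (numq r - numq s).
    move: (`|_|) hs n0 => w hs n0.
    have [w1|w1] : w = 0 \/ 1 <= w by lia.
      by rewrite w1 mul0r in hs.
    by have := ler_wpM2r (ltW s0) w1; lia.
  move: h1 h2; rewrite -/(in_Q0 (Some r)) -/(in_Q0 (Some s)) !in_Q0_nd /=.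
  move: lt_e; rewrite ltq_nd d s1 !mulr1 => lt_e /and3P[_ ? ?] /and3P[_ ? ?].
  have rn : numq r = 0 by lia.
  have sn : numq s = 1 by lia.
  by rewrite -(divq_num_den r) -(divq_num_den s) d s1 rn sn.
have [dlt hf' hm hp] : [/\ denq (edge_minus e) < denq (edge_plus e),
    farey_pair (Some (edge_minus e)) (Some (edge_plus e)),
    in_Q0 (Some (edge_minus e)) & in_Q0 (Some (edge_plus e))].
  rewrite /edge_minus /edge_plus; case: (leP (denq e.1)) => h; split => //.
    by rewrite lt_neqAle dn.
  by rewrite fareyC.
rewrite /edge_hat; move: (edge_minus e) (edge_plus e) dlt hf' hm hp.
move=> m p dlt hf' hm hp.
have [n1 d1] : numq ((numq p - numq m)%:Q / (denq p - denq m)%:Q) = numq p - numq m /\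
    denq ((numq p - numq m)%:Q / (denq p - denq m)%:Q) = denq p - denq m.
  apply: (@frac_num _ _ (denq m) (numq m)); first by rewrite subr_gt0.
  by move: hf' => /eqP /= <-; rewrite -normrN; congr `|_|; ring.
split=> [->|[g1 g2 <-]]; last first.
  have [-> ->] := mediant_nd g2.
  by rewrite !addrK divq_num_den.
have F : farey_pair (Some ((numq p - numq m)%:Q / (denq p - denq m)%:Q)) (Some m).
  rewrite /farey_pair /= n1 d1; move: hf' => /eqP /= <-.
  by rewrite -normrN; apply/eqP; congr `|_|; ring.
split => //.
- move: hm hp hf'; rewrite !in_Q0_nd /farey_pair /= n1 d1.
  move: (numq m) (denq m) (numq p) (denq p) dlt => mn md pn pd dlt.
  move=> /and3P[m0 m1 m2] /and3P[p0 p1 p2] /eqP hd.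
  have E : (pn - mn) * md - (pd - md) * mn = pn * md - pd * mn by ring.
  rewrite subr_gt0 dlt /=; apply/andP; split.
    rewrite leNgt; apply/negP => v0.
    have w1 : (pn - mn) * md <= -1 * md by apply: ler_wpM2r; lia.
    have w2 : 0 <= (pd - md) * mn by apply: mulr_ge0; lia.
    have : md = 1 /\ mn * (pd - md) = 0 by lia.
    case=> me; rewrite me in v0 w1 w2 dlt m2 hd E *.
    by move=> /eqP; rewrite mulf_eq0 => /orP[/eqP h|/eqP h]; lia.
  rewrite leNgt; apply/negP => v0.
  have w1 : (pd - md + 1) * md <= (pn - mn) * md by apply: ler_wpM2r; lia.
  have w2 : (pd - md) * mn <= (pd - md) * md by apply: ler_wpM2l; lia.
  have : md = 1 /\ (pd - md) * mn = (pd - md) * md by lia.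
  case=> me; rewrite me in v0 w1 w2 dlt m2 hd E *.
  have : (pd - 1) * mn = (pd - 1) * 1 -> mn = 1.
    by apply: mulfI; lia.
  by move=> h /h; lia.
have [m1 m2] := mediant_nd F.
by rewrite -(divq_num_den (mediant _ _)) m1 m2 n1 d1 !subrK divq_num_den.
Qed.

(* Main.v *)
Require Import Defs.
From mathcomp Require Import all_boot all_order all_algebra.
From mathcomp Require Import classical_sets reals complex.
From mathcomp Require Import ring lra zify.

Import Order.TTheory GRing.Theory Num.Theory.
Local Open Scope ring_scope.

Set Implicit Arguments.
Unset Strict Implicit.
Unset Printing Implicit Defensive.


(** Write q(r) for the value of the polynomial of r at z, d(r) for that of the
monomial (-1)^p x^q of r = p/q, and L, R for the endpoints of an edge of the
funnel.  The whole proof rests on one explicit solution of the gluing equations.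

The recursion for the polynomials preserves the Markov-type identity
  q(c)^2 + d(R) q(L)^2 + d(L) q(R)^2 = q(L) q(R) q(c),   c = L (+) R,
along the funnel ([apex_identity]).  Give each edge the shape
  Z = - q(L)^2 d(R) / (d(L) q(R)^2).
The identity factors 1 - Z as a monomial times a quotient of values of q at the
four vertices around the edge ([one_sub_kept], [one_sub_new]), so the product of
these factors over the fan of a vertex, the consecutive edges that share this
pivot, telescopes ([fan_closed]).  Consequently the equation of a vertex whose last edge is e_l,
and likewise the upper tunnel equation if that vertex is 0, says precisely that
z_{l+1} is the value of Z at e_{l+1}, once the earlier shapes agree with Z
([dropped_eqP]).

In passing from e_l to e_{l+1} exactly one vertex is dropped.  The equations of
the tangle complement are those of the vertices other than 1 dropped before the
last step, and so they determine every shape from z_1: each z_j is the Z of its edge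
([tangle_follows]).  The shapes lie in the upper half plane, hence differ from 0
and 1, which keeps all the values of q involved away from zero.  The link
imposes two further equations when 1/a is not an integer.  The one of the vertex
dropped at the last step says that Z at e_{n+1} is 1, because z_{n+1} = 1 by
convention; the lower tunnel equation turns out to say the same; and by the
factorisation of 1 - Z this means q(a) = 0 ([hat_eqP], [lower_eqP]).

If 1/a is an integer, all edges share the vertex 0 and the polynomials obey
u_{m+1} = u_m - x u_{m-1}.  Their successive quotients at a nonreal x stay in the
cone spanned by 1 and -x, so q(a) is never 0 ([reciprocal_neq0]).  Since the
equation of the last dropped vertex still forces q(a) = 0, neither side of the
equivalence can hold. *)

(** * The edges of the funnel *)

(** The two sides are indexed by a boolean, [true] for the left one, so that each
argument about a vertex covers both sides at once. *)
Definition side (a : rat) (s : bool) (j : nat) : rat :=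
  if s then (funnel_edge a j).1 else (funnel_edge a j).2.

Definition apex (a : rat) (j : nat) : rat :=
  mediant (side a true j) (side a false j).

Definition kept (a : rat) (j : nat) : bool := a < apex a j.

Lemma side_kept a j : side a (kept a j) j.+1 = side a (kept a j) j.
Proof.
rewrite /kept /apex /side /funnel_edge iterS -/(funnel_edge a j) /funnel_next.
by case: (ltP a).
Qed.

Lemma side_new a j : side a (~~ kept a j) j.+1 = apex a j.
Proof.
rewrite /kept /apex /side /funnel_edge iterS -/(funnel_edge a j) /funnel_next.
by case: (ltP a).
Qed.

Arguments side : simpl never.
Arguments apex : simpl never.
Arguments kept : simpl never.

Lemma side_const a s k l : (k <= l)%N ->
  (forall j, (k <= j < l)%N -> kept a j = s) -> side a s l = side a s k.
Proof.
elim: l => [|l IH]; first by rewrite leqn0 => /eqP->.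
rewrite leq_eqVlt => /orP[/eqP->//|kl] hk.
rewrite -IH //; last by move=> j jl; apply: hk; lia.
by rewrite -[in LHS](hk l) ?side_kept ?(hk l) //; lia.
Qed.

Section Funnel.

Variable a : rat.
Hypotheses (a_gt0 : 0 < a) (a_lt : a < 1 / 2) (a_neq : a <> 1 / 3).

Local Notation n := (funnel_size a).


Lemma size_gt0 : (0 < n)%N.
Proof. by have [] := funnel_sizeP a_gt0 a_lt a_neq. Qed.

Lemma apex_last : apex a n.+1 = a.
Proof. by have [] := funnel_sizeP a_gt0 a_lt a_neq. Qed.

Lemma side_sep j : (j <= n.+1)%N -> side a true j < a < side a false j.
Proof.
move=> jn; have [_ _ _ /(_ j jn)[_ h1 h2 _ _]] := funnel_sizeP a_gt0 a_lt a_neq.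
by apply/andP.
Qed.

Lemma side_in01 s j : (j <= n.+1)%N -> 0 <= side a s j <= 1.
Proof.
move=> jn; have [_ _ _ /(_ j jn)[h0 h1 h2 h3 _]] := funnel_sizeP a_gt0 a_lt a_neq.
by case: s; rewrite /side; lra.
Qed.

Lemma side_farey s j : (j <= n.+1)%N ->
  farey_pair (Some (side a s j)) (Some (side a (~~ s) j)).
Proof.
move=> jn; have [_ _ _ /(_ j jn)[_ _ _ _ h]] := funnel_sizeP a_gt0 a_lt a_neq.
by case: s => //; rewrite fareyC.
Qed.

Lemma apex_nd s j : (j <= n.+1)%N ->
  numq (apex a j) = numq (side a s j) + numq (side a (~~ s) j) /\
  denq (apex a j) = denq (side a s j) + denq (side a (~~ s) j).
Proof.
move=> jn; have [h1 h2] := mediant_nd (side_farey true jn).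
by rewrite /apex h1 h2; case: s => //=; split; rewrite addrC.
Qed.

Lemma apex_between j : (j <= n.+1)%N -> side a true j < apex a j < side a false j.
Proof.
move=> jn; have [h1 h2] := apex_nd true jn; have := side_sep jn.
move=> /andP[ha hb]; have := lt_trans ha hb.
by rewrite !ltq_nd h1 h2 /=; lia.
Qed.

(** Nested intervals: this is what makes the indices of the edges at a given
vertex an interval. *)
Lemma side_mono i j : (i <= j <= n.+1)%N ->
  side a true i <= side a true j /\ side a false j <= side a false i.
Proof.
move=> /andP[ij]; elim: j ij => [|j IH].
  by rewrite leqn0 => /eqP ->.
rewrite leq_eqVlt => /orP[/eqP -> //|ij jn].
have [h1 h2] := IH ij (ltnW jn); have /andP[h3 h4] := apex_between (ltnW jn).
have := side_kept a j; have := side_new a j.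
by case: (kept a j) => /= -> ->; split=> //;
  [exact: le_trans (ltW h4) h2|exact: le_trans h1 (ltW h3)].
Qed.

Lemma side_neq s i j : (i <= n.+1)%N -> (j <= n.+1)%N -> side a s i != side a (~~ s) j.
Proof.
move=> /side_sep/andP[h1 h2] /side_sep/andP[h3 h4].
by case: s; [rewrite lt_eqF // (lt_trans h1)|rewrite gt_eqF // (lt_trans h3)].
Qed.

(** A dropped endpoint is replaced by the mediant, which is strictly closer to
[a], and monotonicity prevents a return. *)
Lemma side_left s j i : (j <= n)%N -> kept a j = ~~ s -> (j < i <= n.+1)%N ->
  side a s i != side a s j.
Proof.
move=> jn kj ij; have [h1 h2] := side_mono ij.
have := side_new a j; rewrite kj negbK => hs.
have /andP[h3 h4] := apex_between (leqW jn).
case: s kj hs => kj hs; rewrite /= hs in h1 h2.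
  by rewrite gt_eqF // (lt_le_trans h3).
by rewrite lt_eqF // (le_lt_trans h2).
Qed.

Lemma incident_side s l j : (l <= n.+1)%N -> (j <= n.+1)%N ->
  incident (side a s l) (funnel_edge a j) = (side a s j == side a s l).
Proof.
move=> ln jn; rewrite /incident -/(side a true j) -/(side a false j).
have := side_neq s ln jn; case: s => /= /negbTE ->; rewrite ?orbF //=;
  by rewrite eq_sym.
Qed.

(** The edges at the vertex [side a s l], up to the [l]-th one, are those from
some [k] on.  The vertex is not on e_0, so it was created as the mediant of
e_{k-1}, whose endpoint on side [s] was dropped at that step. *)
Lemma fan_first s l : (l <= n.+1)%N -> side a s l != side a s 0 ->
  exists k, [/\ (0 < k <= l)%N, kept a k.-1 = ~~ s &
    forall j, (j <= l)%N -> (side a s j == side a s l) = (k <= j)%N].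
Proof.
move=> ln l0; have ex : exists k, side a s k == side a s l by exists l.
case: (ex_minnP ex) => k /eqP kE kmin.
have kl : (k <= l)%N by apply: kmin.
have k0 : (0 < k)%N by case: posnP kE => // -> kE; rewrite -kE eqxx in l0.
exists k; split; first by rewrite k0.
  have [ks|] := eqVneq (kept a k.-1) s; last by case: (kept a _) (s) => -[].
  have := side_kept a k.-1; rewrite ks prednK // => h.
  by have := kmin k.-1; rewrite -h kE eqxx => /(_ isT); lia.
move=> j jl; apply/idP/idP => [/kmin //|kj].
have [h1 h2] : side a true k <= side a true j /\ side a false j <= side a false k.
  by apply: side_mono; rewrite kj (leq_trans jl).
have [h3 h4] : side a true j <= side a true l /\ side a false l <= side a false j.
  by apply: side_mono; rewrite jl.
by case: s {l0 ex kmin} kE => kE; rewrite eq_le; apply/andP; split=> //; rewrite -kE.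
Qed.

Lemma fan_interval s l : (l <= n)%N -> kept a l = ~~ s -> side a s l != side a s 0 ->
  exists k, [/\ (0 < k <= l)%N, kept a k.-1 = ~~ s &
    forall j, (j <= n.+1)%N -> (side a s j == side a s l) = (k <= j <= l)%N].
Proof.
move=> ln kl l0; have [k [k1 k2 k3]] := fan_first (leqW ln) l0.
exists k; split=> // j jn; have [jl|lj] := leqP j l; first by rewrite k3 // andbT.
by rewrite andbF; apply/negbTE/side_left => //; rewrite lj.
Qed.

Lemma fan_kept s k l j : (l <= n.+1)%N ->
  (forall j, (j <= l)%N -> (side a s j == side a s l) = (k <= j)%N) ->
  (k <= j < l)%N -> kept a j = s.
Proof.
move=> ln h /andP[kj jl]; apply/eqP; apply: contraT => ks.
have js : kept a j = ~~ s by case: (kept a j) (s) ks => -[].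
have jn : (j <= n)%N by lia.
have := side_left (i := j.+1) jn js; rewrite ltnSn ltnS jn => /(_ isT).
have /eqP-> : side a s j.+1 == side a s l by rewrite h //; lia.
have /eqP-> : side a s j == side a s l by rewrite h //; lia.
by rewrite eqxx.
Qed.

Lemma side_edge0 : side a true 0 = 0 /\ side a false 0 = 1. Proof. by []. Qed.

Lemma side_edge1 : side a true 1 = 0 /\ side a false 1 = 1 / 2.
Proof. by rewrite /side /funnel_edge /= /funnel_next /= mediant01 a_lt. Qed.

Lemma apex0 : apex a 0 = 1 / 2. Proof. exact: mediant01. Qed.

Lemma kept0 : kept a 0 = true. Proof. by rewrite /kept apex0. Qed.

End Funnel.

(** * Vertices of the funnel and their indices *)

Section FunnelIndices.

Variable a : rat.
Hypotheses (a_gt0 : 0 < a) (a_lt : a < 1 / 2) (a_neq : a <> 1 / 3).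

Local Notation n := (funnel_size a).

Lemma mem_left s l : (l <= n.+1)%N -> (side a s l \in left_side a) = s.
Proof.
move=> ln; apply/mapP; case: ifP => [sE|/negbT sE]; rewrite ?sE.
  by exists l; rewrite // mem_iota add0n ltnS.
move=> [j]; rewrite mem_iota add0n ltnS -/(side a true j) => /= jn /esym/eqP.
by rewrite (negbTE sE) (negbTE (side_neq a_gt0 a_lt a_neq true jn ln)).
Qed.

Lemma side0_true s l : (l <= n.+1)%N -> side a s l = 0 -> s = true.
Proof.
move=> ln; have := side_sep a_gt0 a_lt a_neq ln; case: s => // /andP[_ h] h0.
by move: h; rewrite h0 ltNge (ltW a_gt0).
Qed.

(** The first edge below e_0 is {0, 1/2}: the vertex 1 is dropped at once, and 0 is
the only vertex of e_0 that interior edges can contain. *)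
Lemma side_start s l : (0 < l <= n.+1)%N -> side a s l != 0 ->
  side a s l != side a s 0.
Proof.
move=> /andP[l0 ln]; case: s => //.
have [_] := side_mono a_gt0 a_lt a_neq (i := 1) (j := l) ltac:(by rewrite l0).
rewrite (side_edge1 a_lt).2 (side_edge0 a).2 => h _.
by rewrite lt_eqF // (le_lt_trans h).
Qed.

Lemma side_true_zero l j : (l <= n.+1)%N -> side a true l = 0 -> (j <= l)%N ->
  side a true j = 0.
Proof.
move=> ln l0 jl; have [h _] := side_mono a_gt0 a_lt a_neq (i := j) (j := l) ltac:(lia).
have := side_in01 a_gt0 a_lt a_neq true (leq_trans jl ln).
by move=> /andP[h0 _]; apply/eqP; rewrite eq_le h0 -l0 h.
Qed.

Lemma edge_minusE j : (0 < j <= n.+1)%N ->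
  edge_minus (funnel_edge a j) = 0 <-> side a true j = 0.
Proof.
move=> /andP[j0 jn]; rewrite /edge_minus -/(side a true j) -/(side a false j).
split; last first.
  by move=> ->; rewrite (_ : denq 0 = 1) // -gtz0_ge1 denq_gt0.
case: ifP => // _ h; have := side0_true jn h; by [].
Qed.

Lemma zero_side s j : (j <= n.+1)%N -> (side a s j == 0) = s && (side a true j == 0).
Proof.
by move=> jn; case: s => //=; apply/negP => /eqP /(side0_true jn).
Qed.

Lemma incident0 j : (j <= n.+1)%N -> incident 0 (funnel_edge a j) = (side a true j == 0).
Proof.
move=> jn; rewrite /incident ![0 == _]eq_sym -/(side a true j) -/(side a false j).
by rewrite (zero_side false) ?orbF.
Qed.

(** The numerators of the endpoints of e_{n+1} add up to that of [a], so the
numerator of [a] is 1 exactly if the left endpoint has numerator 0. *)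
Lemma inverse_int : (a^-1 \is a Num.int) = (side a true n.+1 == 0).
Proof.
have [h _] := apex_nd a_gt0 a_lt a_neq true (leqnn n.+1).
have /andP[] := side_in01 a_gt0 a_lt a_neq true (leqnn n.+1).
rewrite -numq_ge0 => L0 _.
have : side a false n.+1 > 0.
  by have /andP[_] := side_sep a_gt0 a_lt a_neq (leqnn n.+1); apply: lt_trans.
rewrite -numq_gt0 => R0.
move: h; rewrite apex_last //= => h.
apply/idP/idP => [/intrP[m mE]|/eqP L].
  have m0 : 0 < m by rewrite -(ltr_int rat) -mE invr_gt0.
  have aE : a = 1%:Q / m%:Q by rewrite -mE div1r invrK.
  have [an _] : numq a = 1 /\ denq a = m.
    by rewrite aE; apply: (@frac_num 1 m 1 0) => //; rewrite mulr1 mulr0.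
  by rewrite -numq_eq0; apply/eqP; lia.
have := side_farey a_gt0 a_lt a_neq true (leqnn n.+1).
rewrite /farey_pair /= L mul0r mulr1 sub0r normrN gtr0_norm // => /eqP R1.
have an : numq a = 1 by rewrite h L R1.
by rewrite -[a]divq_num_den an div1r invrK intr_int.
Qed.

(** The mediant has the larger denominator, so the small endpoint of the last edge
is the one kept from e_n. *)
Lemma last_edgeE : edge_minus (funnel_last a) = side a (kept a n) n /\
  edge_plus (funnel_last a) = apex a n.
Proof.
have [_ hd] := apex_nd a_gt0 a_lt a_neq (kept a n) (leqnSn n).
have dd b : 0 < denq (side a b n) by apply: denq_gt0.
have := side_kept a n; have := side_new a n.
rewrite /edge_minus /edge_plus /funnel_last -/(side a true n.+1) -/(side a false n.+1).
have := dd true; have := dd false.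
by case: (kept a n) hd => /= hd d1 d2 -> ->; rewrite hd; case: leP => //; lia.
Qed.

(** The vertex opposite to e_{n+1} in the triangle above it is the one dropped at
the last step, whose equation the tangle lacks. *)
Lemma hatE : edge_hat (funnel_last a) = side a (~~ kept a n) n.
Proof.
have [hn hd] := apex_nd a_gt0 a_lt a_neq (kept a n) (leqnSn n).
have [em ep] := last_edgeE.
by rewrite /edge_hat em ep hn hd ![_ + _ - _]addrAC !subrr !add0r divq_num_den.
Qed.

Lemma side_neq_last s l : (l <= n)%N -> kept a l = ~~ s ->
  ~~ incident (side a s l) (funnel_last a).
Proof.
move=> ln ls; rewrite /funnel_last incident_side //; last exact: leqW.
by apply: side_left => //; rewrite ltnS ln leqnn.
Qed.

Lemma inner_side s l : (0 < l <= n)%N -> kept a l = ~~ s -> side a s l != 0 ->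
  inner_vertex a (side a s l).
Proof.
move=> /andP[l0 ln] ls b0; apply/and3P; split; last exact: side_neq_last.
  rewrite /funnel_vertices mem_cat; case: s {ls b0}; apply/orP; [left|right];
  by apply/mapP; exists l => //; rewrite mem_iota; lia.
rewrite incident_side ?leqW // eq_sym; apply: side_start => //; lia.
Qed.

Lemma side_neq_hat s l : (0 < l < n)%N -> kept a l = ~~ s ->
  side a s l != edge_hat (funnel_last a).
Proof.
move=> /andP[l0 ln] ls; rewrite hatE eq_sym.
have [->|] := eqVneq (~~ kept a n) s.
  by apply: side_left => //; [exact: ltnW|lia].
move=> h; have -> : ~~ kept a n = ~~ s by case: (kept a n) (s) h => -[].
by rewrite eq_sym; apply: side_neq => //; lia.
Qed.

End FunnelIndices.

Lemma filter_interval (P : pred nat) (m N k l : nat) :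
  (m <= k <= l)%N -> (l < m + N)%N ->
  (forall j, (m <= j < m + N)%N -> P j = (k <= j <= l)%N) ->
  [seq j <- iota m N | P j] = iota k (l.+1 - k).
Proof.
move=> kl lN hP.
have -> : [seq j <- iota m N | P j] = [seq j <- iota m N | (k <= j <= l)%N].
  by apply: eq_in_filter => j; rewrite mem_iota => /hP.
have -> : N = ((k - m) + ((l.+1 - k) + (m + N - l.+1)))%N by lia.
rewrite !iotaD !filter_cat (_ : m + (k - m) = k)%N; last by lia.
rewrite (_ : k + (l.+1 - k) = l.+1)%N; last by lia.
rewrite (eq_in_filter (a2 := pred0)) ?filter_pred0; last first.
  by move=> j; rewrite mem_iota /=; lia.
rewrite (eq_in_filter (a2 := predT)) ?filter_predT; last first.
  by move=> j; rewrite mem_iota /=; lia.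
rewrite (eq_in_filter (a2 := pred0)) ?filter_pred0 ?cats0 //.
by move=> j; rewrite mem_iota /=; lia.
Qed.

(** Serves to read off the first and last indices that occur in the gluing
equations. *)
Lemma filter_head_last (P : pred nat) (m N k l : nat) :
  (m <= k <= l)%N -> (l < m + N)%N ->
  (forall j, (m <= j < m + N)%N -> P j = (k <= j <= l)%N) ->
  head 0%N [seq j <- iota m N | P j] = k /\
  last 0%N [seq j <- iota m N | P j] = l.
Proof.
move=> kl lN hP; rewrite (filter_interval kl lN hP).
have -> : (l.+1 - k = (l - k).+1)%N by lia.
by rewrite -{2}addn1 iotaD last_cat /=; split=> //; lia.
Qed.

(** * The Markov-type identity and the explicit shapes *)

(** Seen as a quadratic equation in [g], the identity has the second root
(b c - db g) / db, the new value given by the recursion up to the factor [db]. *)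
Lemma apex_identity_step (R : comNzRingType) (b g c db dg : R) :
  c ^+ 2 + dg * b ^+ 2 + db * g ^+ 2 = b * g * c ->
  (b * c - db * g) ^+ 2 + db * dg * b ^+ 2 + db * c ^+ 2 =
  b * c * (b * c - db * g).
Proof.
move=> H; have {}H : c ^+ 2 = b * g * c - dg * b ^+ 2 - db * g ^+ 2.
  by rewrite -H; ring.
transitivity (b ^+ 2 * c ^+ 2 - 2 * (b * c * db * g) + db ^+ 2 * g ^+ 2
  + db * dg * b ^+ 2 + db * c ^+ 2); first by ring.
by rewrite [in db * c ^+ 2]H; ring.
Qed.

Section FunnelAlgebra.

Variables (F : fieldType) (q d : rat -> F) (a : rat).
Hypotheses (a_gt0 : 0 < a) (a_lt : a < 1 / 2) (a_neq : a <> 1 / 3).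

Local Notation n := (funnel_size a).

(* [q] and [d] stand for the values of the polynomials and of the monomials at a
point, and the conditions below record how these propagate along the funnel. *)
Hypothesis d_neq0 : forall r, d r != 0.
Hypothesis d_apex : forall j s, (j <= n.+1)%N ->
  d (apex a j) = d (side a s j) * d (side a (~~ s) j).
Hypothesis q_apexS : forall j s, (j <= n)%N -> kept a j = s ->
  q (apex a j.+1) =
    q (side a s j) * q (apex a j) - d (side a s j) * q (side a (~~ s) j).
Hypotheses (q0 : q 0 = 1) (q1 : q 1 = 1) (q12 : q (1 / 2) = 1).
Hypothesis d01 : d 0 + d 1 = 0.

Definition pair_shape (b c : rat) : F := - (q b ^+ 2 * d c) / (d b * q c ^+ 2).

(** For [s = true] this is the shape parameter attached to e_j, and for
[s = false] its inverse.  The equation of a right vertex in the shapes is the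
equation of a left vertex in their inverses. *)
Definition edge_shape (s : bool) (j : nat) : F :=
  pair_shape (side a s j) (side a (~~ s) j).

Definition nonvanishing (l : nat) : Prop :=
  forall s j, (j <= l)%N -> q (side a s j) != 0.

Lemma apex_identity s j : (j <= n.+1)%N ->
  q (apex a j) ^+ 2 + d (side a (~~ s) j) * q (side a s j) ^+ 2
    + d (side a s j) * q (side a (~~ s) j) ^+ 2 =
  q (side a s j) * q (side a (~~ s) j) * q (apex a j).
Proof.
pose I t i := q (apex a i) ^+ 2 + d (side a (~~ t) i) * q (side a t i) ^+ 2
    + d (side a t i) * q (side a (~~ t) i) ^+ 2 =
  q (side a t i) * q (side a (~~ t) i) * q (apex a i).
have swap t u i : I t i -> I u i.
  have [->//|tu] := eqVneq t u; have -> : u = ~~ t by case: (t) (u) tu => -[].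
  by rewrite /I negbK addrAC => ->; rewrite [q (side a t i) * _]mulrC.
move=> jn; apply: (swap true); elim: j jn => [_|j IH jn].
  rewrite /I apex0 (side_edge0 a).1 (side_edge0 a).2 q0 q1 q12.
  by rewrite !expr1n !mulr1 -addrA [d 1 + _]addrC d01 addr0.
apply: (swap (kept a j)); rewrite /I side_kept side_new (@q_apexS _ (kept a j)) //.
rewrite (@d_apex _ (kept a j) (ltnW jn)).
apply: apex_identity_step; exact: swap (IH (ltnW jn)).
Qed.

Lemma edge_shapeN s j : edge_shape (~~ s) j = (edge_shape s j)^-1.
Proof.
rewrite /edge_shape /pair_shape negbK !mulNr invrN invf_div; congr (- _).
by congr (_ / _); rewrite mulrC.
Qed.

Lemma edge_shape_neq0 s j : q (side a true j) != 0 -> q (side a false j) != 0 ->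
  edge_shape s j != 0.
Proof.
move=> h1 h2; have h b : q (side a b j) != 0 by case: b.
by rewrite /edge_shape /pair_shape !(mulf_neq0, oppr_eq0, invr_eq0, expf_neq0) ?h ?d_neq0.
Qed.

Lemma edge_shape_kept s j : (j <= n)%N -> kept a j = s ->
  edge_shape s j.+1 = - (q (side a s j) ^+ 2 * d (side a (~~ s) j)) / q (apex a j) ^+ 2.
Proof.
move=> jn sE; rewrite /edge_shape /pair_shape.
have -> : side a s j.+1 = side a s j by rewrite -sE side_kept.
have -> : side a (~~ s) j.+1 = apex a j by rewrite -sE side_new.
rewrite (@d_apex _ s) ?leqW // mulrCA -mulrN -mulf_div divff ?d_neq0 //.
by rewrite mul1r.
Qed.

Lemma edge_shape1 : edge_shape true 1 = d 0.
Proof.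
rewrite edge_shape_kept ?kept0 // (side_edge0 a).1 (side_edge0 a).2 q0 apex0 q12.
by rewrite expr1n divr1 mul1r; apply/eqP; rewrite eq_sym -addr_eq0 d01.
Qed.

(** Here the pivot on side [s] already belonged to e_j.  The identity at e_j and the
recursion for the next mediant have the factor [q (side a (~~ s) j)] in common. *)
Lemma one_sub_kept s j : (j <= n)%N -> kept a j = s -> q (apex a j) != 0 ->
  1 - edge_shape s j.+1 =
    q (side a (~~ s) j) * q (apex a j.+1) / q (apex a j) ^+ 2.
Proof.
move=> jn sE c0; rewrite edge_shape_kept // (@q_apexS j s) //.
have I := apex_identity s (leqW jn).
apply: (mulIf (expf_neq0 2 c0)).
rewrite mulrBl !divfK ?expf_neq0 // mul1r opprK.
rewrite [in RHS]mulrBr.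
transitivity (q (side a s j) * q (side a (~~ s) j) * q (apex a j)
  - d (side a s j) * q (side a (~~ s) j) ^+ 2).
  by rewrite -I; ring.
ring.
Qed.

(** Here the pivot is the mediant that has just been created.  Follows from
[one_sub_kept] for the other side, since 1 - 1/t = (1 - t) / (- t). *)
Lemma one_sub_new s j : (j <= n)%N -> kept a j = ~~ s -> q (apex a j) != 0 ->
  q (side a (~~ s) j) != 0 ->
  1 - edge_shape s j.+1 =
    q (side a s j) * q (apex a j.+1) / (d (side a s j) * q (side a (~~ s) j) ^+ 2).
Proof.
move=> jn sE c0 g0.
have /(congr1 (fun t => t / - edge_shape (~~ s) j.+1)) := one_sub_kept jn sE c0.
have e0 : edge_shape (~~ s) j.+1 != 0.
  by rewrite edge_shape_kept // negbK !(mulf_neq0, oppr_eq0, invr_eq0, expf_neq0) ?d_neq0.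
have -> : edge_shape s j.+1 = (edge_shape (~~ s) j.+1)^-1 by rewrite edge_shapeN invrK.
have -> : (1 - edge_shape (~~ s) j.+1) / - edge_shape (~~ s) j.+1 =
    1 - (edge_shape (~~ s) j.+1)^-1.
  by rewrite mulrBl invrN mul1r mulrN divff // opprK addrC.
move=> ->; rewrite edge_shape_kept // negbK.
field.
by rewrite opprK !mulf_neq0 ?expf_neq0 ?c0 ?g0 ?d_neq0.
Qed.

(** * Telescoping around a vertex *)

(** With u_j the values at the vertices opposite to a fixed pivot, each factor is
u_{j-1} u_{j+1} / u_j^2. *)
Lemma fan_prod s k l : (k <= l <= n.+1)%N ->
  (forall j, (k <= j < l)%N -> kept a j = s) -> nonvanishing l -> q (apex a k) != 0 ->
  \prod_(k <= j < l) (1 - edge_shape s j.+1) =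
    q (side a (~~ s) k) * q (apex a l) / (q (apex a k) * q (side a (~~ s) l)).
Proof.
move=> /andP[kl]; elim: l kl => [|l IH].
  rewrite leqn0 => /eqP-> _ _ nz c0; rewrite big_geq //.
  by rewrite [q (side _ _ _) * _]mulrC divff // mulf_neq0 // nz.
rewrite leq_eqVlt => /orP[/eqP -> _ _ nz c0|kl ln hk nz c0].
  by rewrite big_geq // [q (side _ _ _) * _]mulrC divff // mulf_neq0 // nz.
have ls : kept a l = s by apply: hk; lia.
have cl : q (apex a l) != 0 by rewrite -side_new; apply: nz.
have hk' j : (k <= j < l)%N -> kept a j = s by move=> jl; apply: hk; lia.
have nz' : nonvanishing l by move=> s' j jl; apply: nz; lia.
have -> : side a (~~ s) l.+1 = apex a l by rewrite -ls side_new.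
rewrite big_nat_recr //= (IH kl (ltnW ln) hk' nz' c0) one_sub_kept //.
have gl : q (side a (~~ s) l) != 0 by apply: nz; lia.
by field; rewrite c0 cl gl.
Qed.

Lemma fan_closed s k l : (0 < k <= l)%N -> (l <= n.+1)%N -> kept a k.-1 = ~~ s ->
  (forall j, (k <= j < l)%N -> kept a j = s) -> nonvanishing l -> q (apex a k) != 0 ->
  \prod_(k <= j < l.+1) (1 - edge_shape s j) =
    q (side a s k.-1) * q (apex a l) /
    (d (side a s k.-1) * q (side a (~~ s) k.-1) * q (side a (~~ s) l)).
Proof.
case: k => // k /andP[_ kl] ln /= ks hk nz c0.
have ck : q (apex a k) != 0 by rewrite -side_new; apply: nz.
have gk : q (side a (~~ s) k) != 0 by apply: nz; lia.
rewrite big_nat_recl //= one_sub_new //; last by lia.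
rewrite fan_prod ?kl // -[in side a (~~ s) k.+1]ks side_kept ks.
have gl : q (side a (~~ s) l) != 0 by apply: nz.
by field; rewrite c0 gl gk d_neq0.
Qed.

(** The pivot of the fan is the mediant of e_{k-1}. *)
Lemma d_pivot s k l : (0 < k <= l)%N -> (k <= n.+1)%N -> kept a k.-1 = ~~ s ->
  (forall j, (k <= j < l)%N -> kept a j = s) ->
  d (side a s l) = d (side a s k.-1) * d (side a (~~ s) k.-1).
Proof.
move=> /andP[k0 kl] kn ks hk; rewrite (side_const kl hk) -(@d_apex _ s); last by lia.
by rewrite -side_new ks negbK prednK.
Qed.

(** The shapes just before and just after the fan multiply to the square of the
telescoped product, because the pivot is the mediant of e_{k-1} and is one of the
two vertices whose mediant is created after e_l. *)
Lemma fan_eq s k l t : (0 < k <= l)%N -> (l <= n)%N -> kept a k.-1 = ~~ s ->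
  kept a l = ~~ s ->
  (forall j, (k <= j < l)%N -> kept a j = s) -> nonvanishing l.+1 ->
  edge_shape s k.-1 * t = (\prod_(k <= j < l.+1) (1 - edge_shape s j)) ^+ 2 <->
  t = edge_shape s l.+1.
Proof.
move=> kl ln ks ls hk nz.
have nz' : nonvanishing l by move=> s' j jl; apply: nz; lia.
have ak j : (j <= l)%N -> q (apex a j) != 0 by move=> jl; rewrite -side_new; apply: nz.
have e0 : edge_shape s k.-1 != 0 by apply: edge_shape_neq0; apply: nz; lia.
have E : edge_shape s k.-1 * edge_shape s l.+1 =
    (\prod_(k <= j < l.+1) (1 - edge_shape s j)) ^+ 2.
  rewrite (fan_closed kl (leqW ln)) //; last by apply: ak; lia.
  rewrite /edge_shape /pair_shape.
  have -> : side a s l.+1 = apex a l by rewrite -[s]negbK -ls side_new.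
  have -> : side a (~~ s) l.+1 = side a (~~ s) l by rewrite -ls side_kept.
  rewrite (@d_apex _ s) ?leqW //.
  rewrite (d_pivot kl _ ks hk); last by lia.
  field.
  by rewrite !nz ?d_neq0 //; lia.
by split=> [|->//]; rewrite -E => /(mulfI e0).
Qed.

Lemma apex_neq0 s j : kept a j = s -> edge_shape s j.+1 != 1 -> (j < n)%N ->
  nonvanishing j.+1 -> q (apex a j.+1) != 0.
Proof.
move=> ks e1 jn nz; have c0 : q (apex a j) != 0 by rewrite -side_new; apply: nz.
apply: contra_neq e1 => h; have := one_sub_kept (ltnW jn) ks c0.
by rewrite h mulr0 mul0r => /eqP; rewrite subr_eq0 => /eqP.
Qed.

Lemma edge_shape_eq1 s t j : (edge_shape s j == 1) = (edge_shape t j == 1).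
Proof.
have [->//|st] := eqVneq s t; have -> : s = ~~ t by case: (s) (t) st => -[].
by rewrite edge_shapeN -[LHS](inj_eq invr_inj) invrK invr1.
Qed.

Lemma nonvanishing0 : nonvanishing 0.
Proof.
by move=> s j; rewrite leqn0 => /eqP->; case: s; rewrite ?(side_edge0 a).1
  ?(side_edge0 a).2 ?q0 ?q1 oner_neq0.
Qed.

(** By [one_sub_kept], a zero of [q] at the next vertex would make the shape of the
present edge equal to 1. *)
Lemma nonvanishingS l : (l <= n)%N -> nonvanishing l ->
  ((0 < l)%N -> edge_shape true l != 1) -> nonvanishing l.+1.
Proof.
move=> ln nz e1.
have c0 : q (apex a l) != 0.
  case: l ln nz e1 => [|l] ln nz e1; first by rewrite apex0 q12 oner_neq0.
  by apply: (@apex_neq0 (kept a l)) => //; rewrite (edge_shape_eq1 _ true) e1.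
move=> s j; rewrite leq_eqVlt => /orP[/eqP->|]; last exact: nz.
have [sE|sE] : s = kept a l \/ s = ~~ kept a l by case: (s) (kept a l) => -[]; auto.
  by rewrite sE side_kept; apply: nz.
by rewrite sE side_new.
Qed.

Lemma edge_shape_last s : nonvanishing n.+1 ->
  (edge_shape s n.+1 == 1) = (q a == 0).
Proof.
move=> nz; rewrite (edge_shape_eq1 s (kept a n)).
have c0 : q (apex a n) != 0 by rewrite -side_new; apply: nz.
rewrite eq_sym -subr_eq0 one_sub_kept // apex_last //.
rewrite !mulf_eq0 invr_eq0 expf_eq0 /= (negbTE c0) orbF.
by rewrite (negbTE (nz _ _ (leqnSn n))).
Qed.

(** Both sides are a common square times q(b)^2 d(g) and - q(c)^2, respectively,
with b the pivot, c the mediant of e_n and g the vertex of e_n opposite to b; the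
equality of these two is the condition on e_{n+1} = {b, c}. *)
Lemma lower_fan_eq s k : (0 < k <= n)%N -> kept a k.-1 = ~~ s ->
  (forall j, (k <= j < n.+1)%N -> kept a j = s) -> nonvanishing n.+1 ->
  edge_shape s k.-1 * edge_shape s n =
    - (\prod_(k <= j < n.+1) (1 - edge_shape s j)) ^+ 2 <->
  edge_shape s n.+1 = 1.
Proof.
move=> kn ks hk nz.
have nz' : nonvanishing n by move=> s' j jl; apply: nz; lia.
have ak j : (j <= n)%N -> q (apex a j) != 0 by move=> jl; rewrite -side_new; apply: nz.
rewrite (fan_closed kn) ?leqnSn //; last by apply: ak; lia.
  rewrite edge_shape_kept //; last by apply: hk; lia.
  rewrite /edge_shape /pair_shape.
  rewrite (@d_pivot s k n kn _ ks); [|by lia|by move=> j jk; apply: hk; lia].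
  have := nz' s k.-1; have := nz' (~~ s) k.-1; have := nz' s n (leqnn _).
  have := nz' (~~ s) n (leqnn _); have := ak n (leqnn _).
  have := d_neq0 (side a s k.-1); have := d_neq0 (side a (~~ s) k.-1).
  have := d_neq0 (side a (~~ s) n).
  have le : (k.-1 <= n)%N by lia.
  move: (q (apex a n)) (q (side a s n)) (q (side a (~~ s) n)) (d (side a (~~ s) n)).
  move: (q (side a s k.-1)) (q (side a (~~ s) k.-1)).
  move: (d (side a s k.-1)) (d (side a (~~ s) k.-1)).
  move=> de dg qe qg c b h dh dh0 dg0 de0 c0 h0 b0 /(_ le) qg0 /(_ le) qe0.
  (* The subscripts e and g refer to the endpoints of e_{k-1}; h is the value at
     the vertex of e_n opposite to the pivot. *)
  pose m := (qe / (de * qg * h)) ^+ 2.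
  have m0 : m != 0 by rewrite expf_neq0 // !mulf_neq0 ?invr_neq0 ?mulf_neq0.
  have -> : - (qe ^+ 2 * dg) / (de * qg ^+ 2) * (- (b ^+ 2 * dh) / (de * dg * h ^+ 2)) =
    m * (b ^+ 2 * dh) by rewrite /m; field; rewrite qg0 de0 dg0 h0.
  have -> : - (qe * c / (de * qg * h)) ^+ 2 = m * - c ^+ 2.
    by rewrite /m; field; rewrite qg0 de0 h0.
  split=> [/(mulfI m0) ->|/(congr1 (fun t => t * - c ^+ 2))].
    by rewrite opprK divff ?expf_neq0.
  by rewrite mulrN divfK ?expf_neq0 // mul1r opprK => ->.
by move=> j jk; apply: hk; lia.
Qed.

(** The fan around 0 begins at e_0, so that no newly created pivot enters and the
product telescopes to a single quotient; the sign comes from d(1) = - d(0). *)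
Lemma upper_fan_eq l t : (0 < l <= n)%N -> kept a l = false ->
  (forall j, (j < l)%N -> kept a j = true) -> nonvanishing l.+1 ->
  edge_shape true 1 * t = - (\prod_(1 <= j < l.+1) (1 - edge_shape true j)) ^+ 2 <->
  t = edge_shape true l.+1.
Proof.
move=> /andP[l0 ln] ls hk nz.
have nz' : nonvanishing l by move=> s' j jl; apply: nz; lia.
have c0 : q (apex a 0) != 0 by rewrite apex0 q12 oner_neq0.
have zE : side a true l = 0 by rewrite (side_const (leq0n l)) ?(side_edge0 a).1.
have g0 : q (side a false l) != 0 by apply: nz.
have E : edge_shape true 1 * edge_shape true l.+1 =
    - (\prod_(1 <= j < l.+1) (1 - edge_shape true j)) ^+ 2.
  rewrite big_add1 /= fan_prod ?leqW //.
  rewrite edge_shape1 (side_edge0 a).2 q1 apex0 q12 !mul1r.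
  rewrite /edge_shape /pair_shape.
  have -> : side a true l.+1 = apex a l by have := side_new a l; rewrite ls.
  have -> : side a (~~ true) l.+1 = side a false l by have := side_kept a l; rewrite ls.
  rewrite (@d_apex _ true) ?leqW // zE //=.
  by field; rewrite g0 !d_neq0.
have e0 : edge_shape true 1 != 0 by rewrite edge_shape1 d_neq0.
by split=> [|->//]; rewrite -E => /(mulfI e0).
Qed.

(** * The gluing equations in terms of the explicit shapes *)

Definition orient (s : bool) (t : F) : F := if s then t else t^-1.

Lemma orientM s t u : orient s (t * u) = orient s t * orient s u.
Proof. by case: s => //=; rewrite invfM. Qed.

Lemma orientX s t m : orient s (t ^+ m) = orient s t ^+ m.
Proof. by case: s => //=; rewrite exprVn. Qed.

Lemma orientK s : involutive (orient s).
Proof. by case: s => t //=; rewrite invrK. Qed.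

Lemma orient_edge_shape s j : orient s (edge_shape true j) = edge_shape s j.
Proof. by case: s => //=; rewrite -edge_shapeN. Qed.

(** On the right side the corner is zeta (zeta t) = 1 - 1/t. *)
Lemma corner_orient s l t : (l <= n.+1)%N -> t != 0 -> t != 1 ->
  corner a (side a s l) t = orient s (1 - orient s t)^-1.
Proof.
move=> ln t0 t1; rewrite /corner mem_left // /zeta; case: s => //=.
rewrite invrK; field.
by rewrite t0 subr_eq0 eq_sym t1 addrAC subrr add0r oppr_eq0 t0.
Qed.

(** The constant [e] is 1 for a vertex equation and -1 for a tunnel equation. *)
Lemma fan_orient s l k m (e u v : F) (f : nat -> F) : (l <= n.+1)%N ->
  (forall j, (k <= j < m)%N -> f j != 0 /\ f j != 1) -> e^-1 = e ->
  e = u * v * (\prod_(k <= j < m) corner a (side a s l) (f j)) ^+ 2 <->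
  orient s u * orient s v = e * (\prod_(k <= j < m) (1 - orient s (f j))) ^+ 2.
Proof.
move=> ln f01 eV.
have p0 : \prod_(k <= j < m) (1 - orient s (f j)) != 0.
  rewrite prodf_seq_neq0; apply/allP => j; rewrite mem_index_iota /= => /f01[f0 f1].
  rewrite subr_eq0 eq_sym; case: s => //=.
  by rewrite -[1]invr1 (inj_eq invr_inj).
have -> : \prod_(k <= j < m) corner a (side a s l) (f j) =
    orient s (\prod_(k <= j < m) (1 - orient s (f j)))^-1.
  rewrite -prodfV (big_morph _ (orientM s) (_ : _ = 1)).
    by apply: eq_big_nat => j /f01[f0 f1]; rewrite corner_orient.
  by case: (s) => //=; rewrite invr1.
move: p0; move: (\prod_(_ <= _ < _) _) => p p0.
have oe : orient s e = e by case: (s).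
have oE : orient s (u * v * orient s p^-1 ^+ 2) =
    orient s u * orient s v * p^-1 ^+ 2.
  by rewrite (orientM s (u * v)) (orientM s u) orientX orientK.
have pV : p^-1 ^+ 2 * p ^+ 2 = 1 by rewrite -exprMn mulVf // expr1n.
split=> [eE|E].
  by rewrite -{1}oe eE oE -mulrA pV mulr1.
apply: (can_inj (orientK s)); rewrite oe oE E -mulrA.
by rewrite [p ^+ 2 * _]mulrC pV mulr1.
Qed.

Local Notation shape := Defs.shape.

Variable z : n.-tuple F.
Hypothesis z01 : forall j, (0 < j <= n)%N -> shape z j != 0 /\ shape z j != 1.
Hypothesis z1 : shape z 1 = d 0.

Lemma shape0 : shape z 0 = 1. Proof. by []. Qed.
Lemma shape_last : shape z n.+1 = 1.
Proof. by rewrite /shape /= nth_default // size_tuple. Qed.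

Definition follows (l : nat) : Prop :=
  forall j, (j <= l)%N -> shape z j = edge_shape true j.

Lemma follows0 : follows 0.
Proof.
move=> j; rewrite leqn0 => /eqP->; rewrite shape0 /edge_shape /pair_shape.
rewrite (side_edge0 a).1 (side_edge0 a).2 q0 q1 expr1n mul1r mulr1.
by move/eqP: d01; rewrite addrC addr_eq0 => /eqP ->; rewrite opprK divff.
Qed.

Lemma follows_nonvanishing l : (l <= n)%N -> follows l -> nonvanishing l.+1.
Proof.
elim: l => [|l IH] ln fl.
  by apply: nonvanishingS => //; apply: nonvanishing0.
apply: nonvanishingS => //.
  by apply: IH => [|j jl]; [apply: ltnW|apply: fl; lia].
by move=> _; rewrite -fl //; apply: (z01 (j := l.+1) _).2.
Qed.

Lemma prod_orient s k m : follows m.-1 -> (0 < m)%N ->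
  \prod_(k <= j < m) (1 - orient s (shape z j)) = \prod_(k <= j < m) (1 - edge_shape s j).
Proof.
by move=> fl m0; apply: eq_big_nat => j jm; rewrite fl ?orient_edge_shape //; lia.
Qed.

(** The vertex 0 lies on e_0 and has no vertex equation; the upper tunnel equation
takes its place. *)
Definition dropped_eq (b : rat) : Prop :=
  if b == 0 then upper_tunnel_eq z else vertex_eq b z.

(** The vertex dropped after e_l has its last edge there, so that its equation
involves z_{l+1} and otherwise only earlier shapes. *)
Lemma dropped_eqP s l : (0 < l <= n)%N -> kept a l = ~~ s -> follows l ->
  dropped_eq (side a s l) <-> shape z l.+1 = edge_shape true l.+1.
Proof.
move=> l0n ls fl; have /andP[l0 ln] := l0n.
have nz := follows_nonvanishing ln fl.
have zj k j : (0 < k)%N -> (k <= j < l.+1)%N -> shape z j != 0 /\ shape z j != 1.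
  by move=> k0 jl; apply: z01; lia.
rewrite /dropped_eq; case: eqP => [b0|/eqP b0].
  have sT := side0_true a_gt0 a_lt a_neq (leqW ln) b0; rewrite sT /= in ls b0 *.
  have zE j : (j <= n.+1)%N -> (side a true j == 0) = (j <= l)%N.
    move=> jn; have [jl|lj] := leqP j l.
      by apply/eqP; apply: (side_true_zero a_gt0 a_lt a_neq _ b0 jl); lia.
    by apply/negbTE; rewrite -b0; apply: side_left => //; rewrite lj.
  rewrite /upper_tunnel_eq; have -> : upper_index a = l.
    apply: (@filter_head_last _ _ _ 1 l _ _ _).2; try lia.
    move=> j jn; rewrite (_ : (1 <= j <= l)%N = (j <= l)%N); last by lia.
    rewrite -zE; last by lia.
    by apply/eqP/eqP => /(edge_minusE a_gt0 a_lt a_neq) -> //; lia.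
  have -> : \prod_(1 <= j < l.+1) zeta (shape z j) =
      \prod_(1 <= j < l.+1) corner a (side a true 0) (shape z j).
    by apply: eq_bigr => j _; rewrite /corner mem_left.
  rewrite fan_orient ?invrN1 //; last by move=> j; apply: zj.
  rewrite prod_orient //= mulN1r fl // upper_fan_eq //.
  move=> j jl; have := side_new a j; case: (kept a j) => //= h.
  have := apex_between a_gt0 a_lt a_neq (j := j) ltac:(lia).
  have /eqP-> : side a true j == 0 by rewrite zE; lia.
  by rewrite -h; have /eqP-> : side a true j.+1 == 0; [rewrite zE; lia|rewrite ltxx].
have l00 := side_start a_gt0 a_lt a_neq (l := l) ltac:(lia) b0.
have [k [kl ks kE]] := fan_interval a_gt0 a_lt a_neq ln ls l00.
rewrite /vertex_eq; have [-> ->] : first_interior a (side a s l) = k /\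
    last_interior a (side a s l) = l.
  apply: filter_head_last; try lia.
  by move=> j jn; rewrite (incident_side a_gt0) ?kE //; lia.
rewrite fan_orient ?invr1 //; [|lia|]; last by move=> j; apply: zj; lia.
rewrite prod_orient //= mul1r fl; last by lia.
rewrite orient_edge_shape fan_eq //.
  by rewrite -orient_edge_shape; split=> [/(can_inj (orientK s))|->].
move=> j jl; apply: (fan_kept a_gt0 a_lt a_neq (l := l) (k := k)) => //; first by lia.
by move=> i il; rewrite kE; lia.
Qed.

(** The equations of the tangle are those of the vertices dropped after e_1 and
before e_{n+1} is reached; each of them extends the agreement with the explicit shapes by one index. *)
Lemma tangle_follows :
  (forall b, inner_vertex a b -> b != edge_hat (funnel_last a) -> vertex_eq b z) ->
  (~~ incident 0 (funnel_last a) -> 0 != edge_hat (funnel_last a) ->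
    upper_tunnel_eq z) -> follows n.
Proof.
move=> hv hu; suff H l : (l <= n)%N -> follows l by apply: H.
elim: l => [|l IH] ln; first exact: follows0.
move=> j; rewrite leq_eqVlt => /orP[/eqP->|]; last exact: (IH (ltnW ln)).
case: l IH ln => [|l] IH ln; first by rewrite z1 edge_shape1.
have lk : kept a l.+1 = ~~ ~~ kept a l.+1 by rewrite negbK.
have l0n : (0 < l.+1 < n)%N by [].
have l1n : (0 < l.+1 <= n)%N by lia.
apply/(dropped_eqP l1n lk (IH (ltnW ln))).
rewrite /dropped_eq; have := side_neq_hat a_gt0 a_lt a_neq l0n lk.
have := side_neq_last a_gt0 a_lt a_neq (ltnW ln) lk.
case: (_ =P 0) => [->|/eqP b0] h1 h2; first exact: hu.
by apply: hv => //; apply: inner_side.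
Qed.

(** The fan of the last dropped vertex ends at e_n, and the shape that follows it
is z_{n+1} = 1. *)
Lemma hat_eqP : follows n -> dropped_eq (edge_hat (funnel_last a)) <-> q a = 0.
Proof.
move=> fn; rewrite hatE // dropped_eqP ?negbK //; last by rewrite size_gt0 //=.
rewrite shape_last; have := edge_shape_last true (follows_nonvanishing (leqnn n) fn).
by rewrite eq_sym => h; split=> [/eqP|/eqP]; [rewrite h|rewrite -h] => /eqP.
Qed.

Lemma lower_eqP : follows n -> side a true n.+1 != 0 ->
  lower_tunnel_eq z <-> q a = 0.
Proof.
move=> fn e0; have nz := follows_nonvanishing (leqnn n) fn.
pose s := kept a n.
have b0 : side a s n.+1 != 0 by rewrite zero_side // (negbTE e0) andbF.
have bs := side_start a_gt0 a_lt a_neq (l := n.+1) (leqnn _) b0.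
have [k [kn ks kE]] := fan_first a_gt0 a_lt a_neq (leqnn n.+1) bs.
have kn' : (k <= n)%N.
  by rewrite -kE ?leqnSn // side_kept.
have minusE : edge_minus (funnel_last a) = side a s n.+1.
  by rewrite (last_edgeE a_gt0 a_lt a_neq).1 side_kept.
rewrite /lower_tunnel_eq minusE.
have -> : lower_index a = k.
  apply: (@filter_head_last _ _ _ k n.+1 _ _ _).1; try lia.
  by move=> j jn; rewrite minusE incident_side // ?kE; lia.
rewrite fan_orient ?invrN1 //; last first.
  by move=> j jk; apply: z01; lia.
rewrite prod_orient //= mulN1r !fn ?orient_edge_shape //; last by lia.
have hk j : (k <= j < n.+1)%N -> kept a j = s.
  by move=> jk; apply: (fan_kept a_gt0 a_lt a_neq (l := n.+1) (k := k)).
rewrite lower_fan_eq //; last by lia.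
have := edge_shape_last s nz.
by move=> h; split=> [/eqP|/eqP]; [rewrite h|rewrite -h] => /eqP.
Qed.

End FunnelAlgebra.

(** * A recursion without nonreal zeros *)

Lemma cone_neq0 (C : numClosedFieldType) (x A B : C) : x \isn't Num.real ->
  1 <= A -> 0 <= B -> A - B * x != 0.
Proof.
move=> xR A1 B0; apply: contra xR; rewrite subr_eq0 => /eqP AE.
have A0 : 0 < A by apply: lt_le_trans A1.
have Bn : B != 0 by apply: contraTneq A0 => Bz; rewrite AE Bz mul0r ltxx.
have -> : x = A / B by rewrite AE mulrC mulKf.
by rewrite rpredM ?rpredV ?ger0_real // ltW.
Qed.

(** If r = A - B x then - x / r is - x (A - B y) / |r|^2 with y the conjugate of x, that is
(B |x|^2 - A x) / |r|^2, which is in the cone spanned by 1 and - x. *)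
Lemma cone_step (C : numClosedFieldType) (x A B : C) : x \isn't Num.real ->
  1 <= A -> 0 <= B ->
  exists A' B', [/\ 1 <= A', 0 <= B' & 1 - x / (A - B * x) = A' - B' * x].
Proof.
move=> xR A1 B0; have r0 := cone_neq0 xR A1 B0.
have A0 : 0 <= A by apply: le_trans A1.
pose N := `|A - B * x| ^+ 2; have N0 : 0 < N by rewrite exprn_gt0 ?normr_gt0.
exists (1 + B * `|x| ^+ 2 / N), (A / N); split.
- by rewrite lerDl divr_ge0 ?mulr_ge0 ?exprn_ge0 // ltW.
- by rewrite divr_ge0 // ltW.
have NE : N = (A - B * x) * (A - B * x^*).
  rewrite /N normCK rmorphB rmorphM /=.
  by rewrite (conj_Creal (ger0_real A0)) (conj_Creal (ger0_real B0)).
have -> : x / (A - B * x) = x * (A - B * x^*) / N.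
  rewrite NE invfM mulrACA mulfV ?mulr1 //.
  by apply: contraTneq N0 => h; rewrite NE h mulr0 ltxx.
by rewrite normCK; field; rewrite gt_eqF.
Qed.

(** * Values of the Farey polynomials at a point *)

Lemma evalC_dQ (R : realType) (r : rat) (x : R[i]) :
  evalC (dQ (Some r)) x = (-1) ^+ `|numq r|%N * x ^+ `|denq r|%N.
Proof.
rewrite /evalC /dQ rmorphM rmorphXn rmorphN1 /= map_polyXn hornerM hornerXn.
by rewrite -polyC1 -polyCN -polyC_exp hornerC.
Qed.

Lemma mediantC r s : mediant r s = mediant s r.
Proof. by rewrite /mediant addrC [denq r + _]addrC. Qed.

Section FareyValues.

Variables (R : realType) (Q : option rat -> {poly int}) (HQ : is_calQ Q).
Variables (a : rat) (x : R[i]).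
Hypotheses (a_gt0 : 0 < a) (a_lt : a < 1 / 2) (a_neq : a <> 1 / 3).
Hypothesis x_gt0 : 0 < complex.Im x.

Local Notation n := (funnel_size a).

Definition qval (r : rat) : R[i] := evalC (Q (Some r)) x.
Definition dval (r : rat) : R[i] := evalC (dQ (Some r)) x.

Lemma not_real : x \isn't Num.real.
Proof.
apply: contraL x_gt0; rewrite realE !lecE => /orP[] /andP[/eqP h _].
  by rewrite h ltxx.
by rewrite -h ltxx.
Qed.

Lemma dval_neq0 r : dval r != 0.
Proof.
rewrite /dval evalC_dQ mulf_neq0 ?expf_neq0 ?oppr_eq0 ?oner_neq0 //.
by apply: contraNneq not_real => ->; rewrite real0.
Qed.

Lemma dval_apex j s : (j <= n.+1)%N ->
  dval (apex a j) = dval (side a s j) * dval (side a (~~ s) j).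
Proof.
move=> jn; have [h1 h2] := apex_nd a_gt0 a_lt a_neq s jn.
have /andP[g1 _] := side_in01 a_gt0 a_lt a_neq s jn.
have /andP[g2 _] := side_in01 a_gt0 a_lt a_neq (~~ s) jn.
rewrite -!numq_ge0 in g1 g2.
have := denq_gt0 (side a s j); have := denq_gt0 (side a (~~ s) j) => d1 d2.
rewrite /dval !evalC_dQ h1 h2 mulrACA -!exprD.
by congr (_ ^+ _ * _ ^+ _); lia.
Qed.

Lemma qval_apexS j s : (j <= n)%N -> kept a j = s ->
  qval (apex a j.+1) =
    qval (side a s j) * qval (apex a j) - dval (side a s j) * qval (side a (~~ s) j).
Proof.
move=> jn ks; have [_ _ _ QE] := HQ.
pose b := side a s j; pose g := side a (~~ s) j.
have m1 : mediant g b = apex a j.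
  by rewrite /apex /b /g; case: (s) => //; rewrite mediantC.
have m2 : mediant (apex a j) b = apex a j.+1.
  have := side_kept a j; have := side_new a j; rewrite ks /b => <- <-.
  by rewrite /apex; case: (s) => //; rewrite mediantC.
have hj := leqW jn.
have M2 : xmediantn 2 (Some g) (Some b) = Some (apex a j.+1).
  by rewrite /xmediantn /= !xmediant_Some m1 m2.
have in01 : in_Q0 (xmediantn 2 (Some g) (Some b)).
  rewrite M2 /=; have /andP[c1 c2] := apex_between a_gt0 a_lt a_neq (j := j.+1) jn.
  have /andP[s1 _] := side_in01 a_gt0 a_lt a_neq true (j := j.+1) jn.
  have /andP[_ s2] := side_in01 a_gt0 a_lt a_neq false (j := j.+1) jn.
  by rewrite (le_trans s1 (ltW c1)) (le_trans (ltW c2) s2).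
have hb : in_hatQ0 (Some b) by rewrite /in_hatQ0 /= side_in01.
have hg : in_hatQ0 (Some g) by rewrite /in_hatQ0 /= side_in01.
have := QE _ _ hb hg (side_farey a_gt0 a_lt a_neq s hj) in01.
rewrite M2 xmediant_Some m1 => E.
rewrite /qval /dval -/b -/g E /evalC; move: (dQ _) => D.
rewrite rmorphD hornerD !rmorphM rmorphN /=.
by rewrite !hornerM hornerN mulNr addrC.
Qed.

Lemma qval0 : qval 0 = 1.
Proof. by have [h _ _ _] := HQ; rewrite /qval h /evalC rmorph1 hornerC. Qed.

Lemma qval1 : qval 1 = 1.
Proof. by have [_ _ h _] := HQ; rewrite /qval h /evalC rmorph1 hornerC. Qed.

(** 1/2 is obtained from 1/0 by adding 0/1 twice. *)
Lemma qval12 : qval (1 / 2) = 1.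
Proof.
have [h0 hi h1 QE] := HQ.
have E : xmediantn 2 None (Some 0) = Some (1 / 2) by exact/eqP.
have E1 : xmediant None (Some 0) = Some 1 by exact/eqP.
have := QE (Some 0) None isT isT isT; rewrite E E1 => /(_ isT).
by rewrite h0 hi h1 mulr0 mulr1 add0r /qval => ->; rewrite /evalC rmorph1 hornerC.
Qed.

Lemma dval01 : dval 0 + dval 1 = 0.
Proof. by rewrite /dval !evalC_dQ mul1r mulN1r subrr. Qed.

Lemma dval0 : dval 0 = x.
Proof. by rewrite /dval evalC_dQ mul1r. Qed.

(** All edges contain 0, so the recursion always has pivot 0 and, after division by
the last value, becomes the map r to 1 - x / r of [cone_step]. *)
Lemma reciprocal_neq0 : side a true n.+1 = 0 -> qval a != 0.
Proof.
move=> s0.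
have sz j : (j <= n.+1)%N -> side a true j = 0.
  by apply: side_true_zero.
have kt j : (j <= n)%N -> kept a j = true.
  move=> jn; have := side_new a j; case: (kept a j) => //= h.
  have /andP[] := apex_between a_gt0 a_lt a_neq (leqW jn).
  by rewrite -h !sz ?ltxx // leqW.
suff H j : (j <= n.+1)%N -> qval (side a false j) != 0 /\
    exists A B, [/\ 1 <= A, 0 <= B &
      qval (apex a j) = (A - B * x) * qval (side a false j)].
  have [g0 [A [B [A1 B0]]]] := H _ (leqnn _).
  by rewrite apex_last // => ->; rewrite mulf_neq0 // cone_neq0 // not_real.
elim: j => [_|j IH jn].
  rewrite (side_edge0 a).2 qval1 oner_neq0; split=> //; exists 1, 0.
  by rewrite apex0 qval12 mul0r subr0 mulr1.
have [g0 [A [B [A1 B0 E]]]] := IH (ltnW jn).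
have r0 := cone_neq0 not_real A1 B0.
have -> : side a false j.+1 = apex a j by have := side_new a j; rewrite kt.
split; first by rewrite E mulf_neq0.
have [A' [B' [A1' B0' E']]] := cone_step not_real A1 B0.
exists A', B'; split=> //.
rewrite (qval_apexS (s := true)) ?kt // sz ?leqW // qval0 dval0 /= -E' E.
by field.
Qed.

Lemma positive_shape (z : n.-tuple R[i]) : positive_shapes z ->
  forall j, (0 < j <= n)%N -> Defs.shape z j != 0 /\ Defs.shape z j != 1.
Proof.
move=> hz [//|j] jn; rewrite /Defs.shape /=.
have /hz : nth 1 z j \in z by apply: mem_nth; rewrite size_tuple.
by move=> h; split; apply: contraTneq h => ->; rewrite /= ltxx.
Qed.

(** The equivalence holds for each tuple of shapes with first entry [x], not only
for the existence of such a tuple. *)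
Lemma link_tangle (z : n.-tuple R[i]) : Defs.shape z 1 = x ->
  hyp_link R a z <-> hyp_tangle R a z /\ qval a = 0.
Proof.
move=> z1; rewrite /hyp_link /hyp_tangle inverse_int // -incident0 //.
rewrite -/(funnel_last a).
have z1d : Defs.shape z 1 = dval 0 by rewrite dval0.
have fol := tangle_follows a_gt0 a_lt a_neq dval_neq0 dval_apex qval_apexS
  qval0 qval1 qval12 dval01 _ z1d.
have hatP := hat_eqP a_gt0 a_lt a_neq dval_neq0 dval_apex qval_apexS
  qval0 qval1 qval12 dval01 _ (z := z).
have lowP := lower_eqP a_gt0 a_lt a_neq dval_neq0 dval_apex qval_apexS
  qval0 qval1 qval12 dval01 _ (z := z).
have hatv : kept a n = ~~ ~~ kept a n by rewrite negbK.
have n1 : (0 < n <= n)%N by rewrite size_gt0 /=.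
have hatin : edge_hat (funnel_last a) != 0 -> inner_vertex a (edge_hat (funnel_last a)).
  by rewrite hatE //; apply: inner_side.
split=> [[pz vz tz]|[[pz vz tz] qa]].
- have z01 := positive_shape pz.
  (* The upper tunnel equation is required of the tangle only if 0 is not on
     e_{n+1}, and then 1/a is not an integer, so the link requires it too. *)
  have T : hyp_tangle R a z.
    split=> // [b bi _|/negbTE i0 _]; first exact: vz.
    by move: tz; rewrite i0 => -[].
  split; first exact: T.
  have f : follows qval dval z n by case: T => _ v u; apply: fol.
  apply/(hatP z01 f); rewrite /dropped_eq.
  case: (_ =P 0) => [h0|/eqP h0]; last by apply: vz; apply: hatin.
  move: tz; case: ifP => [i0|_ []//].
  have := side_neq_last a_gt0 a_lt a_neq (leqnn n) hatv.
  by rewrite -hatE // h0 i0.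
have z01 := positive_shape pz.
have f : follows qval dval z n by apply: fol.
have hq := (hatP z01 f).2 qa.
have h0 : ~~ incident 0 (funnel_last a).
  rewrite incident0 //; apply/negP => /eqP /reciprocal_neq0.
  by rewrite qa eqxx.
rewrite (negbTE h0); split=> // [b bi|].
  have [bh|bh] := eqVneq b (edge_hat (funnel_last a)); last exact: vz.
  have b0 : b != 0.
    apply: contraTneq bi => ->.
    by rewrite /inner_vertex (_ : incident 0 (funnel_edge a 0)) // andbF.
  by move: hq; rewrite /dropped_eq -bh (negbTE b0).
split; last first.
  by apply/(lowP z01 f) => //; rewrite -incident0.
have [bh|bh] := eqVneq 0 (edge_hat (funnel_last a)); last exact: tz.
by move: hq; rewrite /dropped_eq -bh eqxx.
Qed.

End FareyValues.

Theorem theorem4p20 (R : realType) (Q : option rat -> {poly int})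
    (HQ : is_calQ Q) (a : rat) (a_gt0 : 0 < a) (a_lt : a < 1 / 2)
    (a_neq : a <> 1 / 3) (z : R[i]) (z_gt0 : 0 < complex.Im z) :
  first_shape_of (hyp_link R a) z <->
  first_shape_of (hyp_tangle R a) z /\ evalC (Q (Some a)) z = 0.
Proof.
rewrite /first_shape_of -/(qval Q z a).
split=> [[w hw w1]|[[w hw w1] qa]].
  by have [//|hl _] := link_tangle HQ a_gt0 a_lt a_neq z_gt0 (z := w);
    have [ht qa] := hl hw; split=> //; exists w.
exists w => //; have [//|_ ] := link_tangle HQ a_gt0 a_lt a_neq z_gt0 (z := w).
by apply.
Qed.
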